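(* Let $n\ge3$, $0<a<1$ and $\hat m_1,\hat m_2,f\in\mathbb{R}$. The mechanical billiard system defined on the hyperboloid model $\mathcal{H}^n_S$ of $n$-dimensional hyperbolic space by the hyperbolic Lagrange problem, with any finite combination (finite union) of confocal quadrics with foci at the two Kepler centers $Z_1,Z_2$ as reflection walls, is integrable. As subcases, the billiard systems with such walls defined on $\mathcal{H}^n_S$ by the hyperbolic two-center problem ($f=0$), by the hyperbolic Kepler problem ($\hat m_1=f=0$ or $\hat m_2=f=0$; one of the foci is then the Kepler center), and by the hyperbolic Hooke problem ($\hat m_1=\hat m_2=0$; the quadrics are then centered at the Hooke center) are integrable. The first integrals are $$E_{hyp}=\tfrac12\Big(\sum_{i=1}^nq_i'^2-q_{n+1}'^2\Big)-\frac{\hat m_1}{\tanh\theta_{Z_1}}-\frac{\hat m_2}{\tanh\theta_{Z_2}}-f\tanh^2\theta_{Z_0},$$ $$\hat E_{sp}=\tfrac12\Big(\frac{(q_{n+1}q_1'-q_1q_{n+1}')^2}{1-a^2}+\sum_{i=2}^n(q_{n+1}q_i'-q_iq_{n+1}')^2\Big)-f\Big(\frac{q_1^2}{q_{n+1}^2(1-a^2)}+\sum_{i=2}^n\frac{q_i^2}{q_{n+1}^2}\Big)-m_1\Big(\frac{(-q_1/q_{n+1}-a)^2}{1-a^2}+\sum_{i=2}^n\frac{q_i^2}{q_{n+1}^2}\Big)^{-1/2}-m_2\Big(\frac{(-q_1/q_{n+1}+a)^2}{1-a^2}+\sum_{i=2}^n\frac{q_i^2}{q_{n+1}^2}\Big)^{-1/2},$$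 $$\hat C_k=\sum_{2\le i<j\le k}(q_iq_j'-q_jq_i')^2,\qquad3\le k\le n,$$ where $m_i=\hat m_i/\sqrt{1-a^2}$.
   Context: A natural mechanical system $(M,g,U)$ is a Riemannian manifold $(M,g)$ with a force function $U$ (smooth outside a singular set); its motions satisfy $\nabla_{q'}q'=\mathrm{grad}_g U(q)$, where $'$ is the time derivative. A first integral is a function on $TM$ constant along motions. Poisson brackets of functions on $TM$ are those obtained from the canonical bracket of $T^*M$ via $v\mapsto g(v,\cdot)$. The elastic reflection at a point $q$ of a hypersurface $\mathcal{B}$ sends $v=v_t+v_n$ to $v'=v_t-v_n$ ($v_t$ tangent, $v_n$ $g$-normal to $\mathcal{B}$). The billiard system $(M,g,U,\mathcal{B})$, $\dim M=N$, is integrable if there are $N$ functionally independent first integrals of $(M,g,U)$ (differentials linearly independent on an open dense set), pairwise in involution, each satisfying $F(q,v)=F(q,v')$ for all reflections at $\mathcal{B}$. For a finite union of quadrics, reflections are considered at every point (outside singularities of $U$) of each quadric with respect to the tangent space of that quadric. $\mathbb{R}^{n,1}$ is $\mathbb{R}^{n+1}$ with the pseudo-Riemannian metric $\sum_{i=1}^ndq_i^2-dq_{n+1}^2$, and $\mathcal{H}^n_S=\{\sum_{i=1}^nq_i^2-q_{n+1}^2=-1,\ q_{n+1}<0\}$ with the induced Riemannian metric. Kepler centers $Z_1=(\frac{a}{\sqrt{1-a^2}},0,\dots,0,-\frac1{\sqrt{1-a^2}})$, $Z_2=(-\frac{a}{\sqrt{1-a^2}},0,\dots,0,-\frac1{\sqrt{1-a^2}})$,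 Hooke center $Z_0=(0,\dots,0,-1)$. The hyperbolic Lagrange problem has force function $\hat m_1\coth\theta_{Z_1}+\hat m_2\coth\theta_{Z_2}+f\tanh^2\theta_{Z_0}$, where $\theta_Z$ is the hyperbolic angle (hyperbolic distance) between $q$ and $Z$. A quadric in $\mathcal{H}^n_S$ is confocal if it is non-degenerate and is the locus of points for which $\theta_{Z_1}+\theta_{Z_2}$ is a constant $c>d$ (spheroid), or $|\theta_{Z_1}-\theta_{Z_2}|$ is a constant $c$, $0<c<d$ (circular hyperboloid of two sheets), where $d$ is the hyperbolic distance between $Z_1$ and $Z_2$. *)

(* Defs.v *)
From HB Require Import structures.
From mathcomp Require Import all_boot all_order all_algebra.
From mathcomp Require Import all_classical all_reals all_analysis.

Set Implicit Arguments.
Unset Strict Implicit.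
Unset Printing Implicit Defensive.

Import Order.TTheory GRing.Theory Num.Theory.
Import numFieldNormedType.Exports.

Local Open Scope classical_set_scope.
Local Open Scope ring_scope.

Section HyperbolicFunctions.
Variable R : realType.
Implicit Types t y : R.

Definition tanh t : R := (expR t - expR (- t)) / (expR t + expR (- t)).
Definition coth t : R := (expR t + expR (- t)) / (expR t - expR (- t)).

(* The nonnegative inverse of cosh, meaningful for 1 <= y. *)
Definition arcosh y : R := ln (y + Num.sqrt (y ^+ 2 - 1)).

End HyperbolicFunctions.

Section Hyperboloid.
Variables (R : realType) (n : nat).

(* The coordinates q_1, ..., q_{n+1} are indexed from 0: q_i is q 0 (i - 1), so
   the timelike coordinate q_{n+1} is q 0 ord_max, and [lift ord_max] embeds
   the indices of the spacelike ones. *)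
Local Notation V := 'rV[R]_n.+1.

Definition mink (u v : V) : R :=
  \sum_(i < n) u 0 (lift ord_max i) * v 0 (lift ord_max i)
  - u 0 ord_max * v 0 ord_max.

Definition hyperboloid : set V := [set q | mink q q = -1 /\ q 0 ord_max < 0].

(* [tangent q v] is v \in T_q H. *)
Definition tangent (q v : V) : Prop := mink q v = 0.

(* Hyperbolic angle (= hyperbolic distance): cosh theta = - <q, z>. *)
Definition hangle (z q : V) : R := arcosh (- mink q z).

(* Global chart of the hyperboloid, with inverse [hproj]: forgetting q_{n+1}. *)
Definition hproj (q : V) : 'rV[R]_n := \row_i q 0 (lift ord_max i).
Definition chart (x : 'rV[R]_n) : V :=
  \row_j (if unlift ord_max j is Some i then x 0 i
          else - Num.sqrt (1 + \sum_(i < n) x 0 i ^+ 2)).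

(* dU_q(w) for q on the hyperboloid and w tangent at q, computed in the chart;
   only the restriction of U to the hyperboloid matters. *)
Definition dforce (U : V -> R) (q w : V) : R :=
  'D_(hproj w) (U \o chart) (hproj q).

Definition is_grad (U : V -> R) (q w : V) : Prop :=
  tangent q w /\ forall u, tangent q u -> mink w u = dforce U q u.

(* Orthogonal projection onto T_q H; the normal line is spanned by q, with
   <q, q> = -1. *)
Definition tproj (q u : V) : V := u + mink u q *: q.

(* The Levi-Civita covariant derivative of the velocity along a curve in H is
   the tangential part of the ambient acceleration.  S is the singular set
   of U. *)
Definition is_motion (U : V -> R) (S : set V) (t0 t1 : R) (q : R -> V) : Prop :=
  forall t, t0 < t < t1 ->
    [/\ hyperboloid (q t), ~ S (q t), derivable q t 1, derivable (derive1 q) t 1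
      & is_grad U (q t) (tproj (q t) (derive1 (derive1 q) t))].

(* Functions on TH are given as functions of a position and a velocity; only
   their values at (q, v) with q on H and v tangent at q matter. *)
Definition first_integral (U : V -> R) (S : set V) (F : V -> V -> R) : Prop :=
  forall (t0 t1 : R) (q : R -> V), is_motion U S t0 t1 q ->
  forall s t, t0 < s < t1 -> t0 < t < t1 ->
    F (q s) (derive1 q s) = F (q t) (derive1 q t).

Definition dchart (x u : 'rV[R]_n) : V := 'D_u chart x.

Definition gram (x : 'rV[R]_n) : 'M[R]_n :=
  \matrix_(i, j) mink (dchart x (delta_mx 0 i)) (dchart x (delta_mx 0 j)).

(* The tangent vector v at chart x whose covector g(v, .) has the canonical
   momenta p_i = g(v, d chart / d x_i). *)
Definition sharp (x p : 'rV[R]_n) : V := dchart x (p *m invmx (gram x)).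

(* A function on TH in the canonical coordinates (x, p) of T*H. *)
Definition canon_coord (F : V -> V -> R) (z : 'rV[R]_n * 'rV[R]_n) : R :=
  F (chart z.1) (sharp z.1 z.2).

Definition poisson_bracket (F G : V -> V -> R) (z : 'rV[R]_n * 'rV[R]_n) : R :=
  \sum_(i < n)
    ('D_((delta_mx 0 i, 0) : 'rV[R]_n * 'rV[R]_n) (canon_coord F) z *
     'D_((0, delta_mx 0 i) : 'rV[R]_n * 'rV[R]_n) (canon_coord G) z -
     'D_((0, delta_mx 0 i) : 'rV[R]_n * 'rV[R]_n) (canon_coord F) z *
     'D_((delta_mx 0 i, 0) : 'rV[R]_n * 'rV[R]_n) (canon_coord G) z).

Definition regular_phase (S : set V) : set ('rV[R]_n * 'rV[R]_n) :=
  [set z | ~ S (chart z.1)].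

Definition independent_at (k : nat) (F : 'I_k -> V -> V -> R)
    (z : 'rV[R]_n * 'rV[R]_n) : Prop :=
  forall c : 'I_k -> R,
    (forall u, \sum_(i < k) c i * 'd (canon_coord (F i)) z u = 0) ->
    forall i, c i = 0.

(* Tangent vectors to B at q: velocities at q of curves contained in B. *)
Definition wall_tangent (B : set V) (q w : V) : Prop :=
  exists c : R -> V,
    [/\ c 0 = q, is_derive (0 : R) 1 c w & \forall t \near (0 : R), B (c t)].

Definition reflection (B : set V) (q v v' : V) : Prop :=
  exists vt vn : V,
    [/\ wall_tangent B q vt,
        tangent q vn /\ (forall w, wall_tangent B q w -> mink vn w = 0),
        v = vt + vn & v' = vt - vn].

Definition reflection_invariant (S : set V) (walls : set (set V))
    (F : V -> V -> R) : Prop :=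
  forall B, walls B -> forall q v v', B q -> ~ S q ->
    reflection B q v v' -> F q v = F q v'.

Definition integrating_family (U : V -> R) (S : set V) (walls : set (set V))
    (F : 'I_n -> V -> V -> R) : Prop :=
  [/\ forall i, first_integral U S (F i)
        /\ (forall z, regular_phase S z -> differentiable (canon_coord (F i)) z),
      exists O : set ('rV[R]_n * 'rV[R]_n),
        [/\ open O, dense O, O `<=` regular_phase S
          & forall z, O z -> independent_at F z],
      forall i j z, regular_phase S z -> poisson_bracket (F i) (F j) z = 0
    & forall i, reflection_invariant S walls (F i)].

Definition billiard_integrable (U : V -> R) (S : set V)
    (walls : set (set V)) : Prop :=
  exists F : 'I_n -> V -> V -> R, integrating_family U S walls F.

Definition axis_point (s h : R) : V :=
  \row_j (if j == ord0 then s else if j == ord_max then h else 0).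

Definition Z0 : V := axis_point 0 (- 1).
Definition Z1 (a : R) : V :=
  axis_point (a / Num.sqrt (1 - a ^+ 2)) (- (1 / Num.sqrt (1 - a ^+ 2))).
Definition Z2 (a : R) : V :=
  axis_point (- (a / Num.sqrt (1 - a ^+ 2))) (- (1 / Num.sqrt (1 - a ^+ 2))).

Definition kepler_force (Z : V) (m : R) (q : V) : R := m * coth (hangle Z q).
Definition hooke_force (f : R) (q : V) : R := f * tanh (hangle Z0 q) ^+ 2.
Definition two_center_force (a m1 m2 : R) (q : V) : R :=
  kepler_force (Z1 a) m1 q + kepler_force (Z2 a) m2 q.
Definition lagrange_force (a m1 m2 f : R) (q : V) : R :=
  two_center_force a m1 m2 q + hooke_force f q.

(* A center of mass factor 0 is not a singularity. *)
Definition kepler_sing (Z : V) (m : R) : set V := [set q | m != 0 /\ q = Z].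
Definition two_center_sing (a m1 m2 : R) : set V :=
  kepler_sing (Z1 a) m1 `|` kepler_sing (Z2 a) m2.

(* Non-degeneracy is carried by the range of the constant c. *)
Definition confocal_quadric (a : R) (B : set V) : Prop :=
  let d := hangle (Z1 a) (Z2 a) in
  (exists2 c : R, d < c &
     B = [set q | hyperboloid q /\ hangle (Z1 a) q + hangle (Z2 a) q = c])
  \/
  (exists2 c : R, 0 < c < d &
     B = [set q | hyperboloid q /\ `|hangle (Z1 a) q - hangle (Z2 a) q| = c]).

(* The geodesic symmetry of H about Z0. *)
Definition hooke_symmetry (q : V) : V :=
  \row_j (if j == ord_max then q 0 j else - q 0 j).

Definition E_hyp (a m1 m2 f : R) (q v : V) : R :=
  mink v v / 2 - m1 / tanh (hangle (Z1 a) q) - m2 / tanh (hangle (Z2 a) q)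
  - f * tanh (hangle Z0 q) ^+ 2.

(* The coordinates q_2, ..., q_n are the q 0 i with 0 < i < n. *)
Definition E_sp (a mh1 mh2 f : R) (q v : V) : R :=
  let m1 := mh1 / Num.sqrt (1 - a ^+ 2) in
  let m2 := mh2 / Num.sqrt (1 - a ^+ 2) in
  let q1 := q 0 ord0 in let v1 := v 0 ord0 in
  let ql := q 0 ord_max in let vl := v 0 ord_max in
  let s := \sum_(i < n.+1 | (0 < i < n)%N) q 0 i ^+ 2 / ql ^+ 2 in
  ((ql * v1 - q1 * vl) ^+ 2 / (1 - a ^+ 2)
   + \sum_(i < n.+1 | (0 < i < n)%N) (ql * v 0 i - q 0 i * vl) ^+ 2) / 2
  - f * (q1 ^+ 2 / (ql ^+ 2 * (1 - a ^+ 2)) + s)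
  - m1 * (Num.sqrt ((- q1 / ql - a) ^+ 2 / (1 - a ^+ 2) + s))^-1
  - m2 * (Num.sqrt ((- q1 / ql + a) ^+ 2 / (1 - a ^+ 2) + s))^-1.

(* With coordinates numbered from 1, the sum is over 2 <= i < j <= k. *)
Definition C_hat (k : nat) (q v : V) : R :=
  \sum_(i < n.+1) \sum_(j < n.+1 | [&& 0 < i, i < j & j < k]%N)
    (q 0 i * v 0 j - q 0 j * v 0 i) ^+ 2.

(* k >= 2 is matched with C_(k+1), so that the last integral is C_n. *)
Definition lagrange_integrals (a m1 m2 f : R) (l : 'I_n) : V -> V -> R :=
  match val l with
  | 0 => E_hyp a m1 m2 f
  | 1 => E_sp a m1 m2 f
  | k => C_hat k.+1
  end.

End Hyperboloid.

Arguments Z0 {R n}.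
Arguments Z1 {R n} a.
Arguments Z2 {R n} a.

(* Main.v *)
(* In the chart x = (q_1, ..., q_n) with canonical momenta p, writing W = |q_{n+1}|
   = sqrt (1 + |x|^2), the integrals become
     E_hyp = (|p|^2 + (p.x)^2) / 2 - U(x),
     E_sp  = W^2 (p_1^2 / (1 - a^2) + p_2^2 + ... + p_n^2) / 2 - V(x),
     C_k   = |x'|^2 |p'|^2 - (x'.p')^2,  ' keeping the coordinates 2, ..., k.
   The part of {E_hyp, E_sp} cubic in p cancels and the part linear in p vanishes
   by two scalar identities between the gradients of U and V, which are stable
   under linear combinations and checked for one Kepler and one Hooke term; the
   other brackets vanish by rotational symmetry.  A motion is an integral curve of
   the Hamiltonian vector field of E_hyp, so involution with E_hyp gives
   conservation.  The momentum gradients do not involve U and V, and are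
   independent where finitely many non-zero polynomials in x and p do not vanish.
   By the addition theorem for cosh, a confocal wall is a central quadric
   q_2^2 + ... + q_n^2 - nu q_1^2 = mu of the chart; its normal covector is
   orthogonal to its tangent covectors for the quadratic form of E_sp exactly
   because of the relation between mu and nu that expresses confocality. *)
From HB Require Import structures.
Require Import Defs.
From mathcomp Require Import all_boot all_order all_algebra.
From mathcomp Require Import all_classical all_reals all_analysis.
From mathcomp Require Import zify ring lra.

Set Implicit Arguments.
Unset Strict Implicit.
Unset Printing Implicit Defensive.

Import Order.TTheory GRing.Theory Num.Theory.
Import numFieldNormedType.Exports.

Local Open Scope classical_set_scope.
Local Open Scope ring_scope.

(** * Differential calculus *)

Section Calculus.
Variables (R : realType) (E : normedModType R).
Implicit Types (f g df dg : E -> R) (z : E).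

(** These rules display both the function and its differential as abstractions, so that applying
    them along the syntax of an expression computes its differential; [is_diff_eq] then leaves an
    algebraic identity. *)
Lemma is_diff_cstf z (c : R) : is_diff z (fun=> c) (fun=> 0).
Proof. exact: is_diff_cst. Qed.

Lemma is_diff_addf z f g df dg : is_diff z f df -> is_diff z g dg ->
  is_diff z (fun y => f y + g y) (fun u => df u + dg u).
Proof. exact: is_diffD. Qed.

Lemma is_diff_subf z f g df dg : is_diff z f df -> is_diff z g dg ->
  is_diff z (fun y => f y - g y) (fun u => df u - dg u).
Proof. exact: is_diffB. Qed.

Lemma is_diff_mulf z f g df dg : is_diff z f df -> is_diff z g dg ->
  is_diff z (fun y => f y * g y) (fun u => f z * dg u + g z * df u).
Proof. exact: is_diffM. Qed.

Lemma is_diff_scalef z (c : R) f df : is_diff z f df ->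
  is_diff z (fun y => c * f y) (fun u => c * df u).
Proof. exact: is_diffZ. Qed.

Lemma is_diff_sumf z (I : Type) (s : seq I) (P : pred I) (f df : I -> E -> R) :
  (forall i, is_diff z (f i) (df i)) ->
  is_diff z (fun y => \sum_(i <- s | P i) f i y)
    (fun u => \sum_(i <- s | P i) df i u).
Proof.
move=> fdf; elim: s => [|i s ih].
  under eq_fun do rewrite big_nil; under [X in is_diff _ _ X]eq_fun do rewrite big_nil.
  exact: is_diff_cstf.
under eq_fun do rewrite big_cons; under [X in is_diff _ _ X]eq_fun do rewrite big_cons.
by case: (P i) => //; apply: is_diff_addf.
Qed.

Lemma is_diff_realcomp z f df (phi : R -> R) (d : R) : is_diff z f df ->
  is_derive (f z) 1 phi d -> is_diff z (fun y => phi (f y)) (fun u => d * df u).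
Proof.
move=> fdf phid; have phi_diff : differentiable phi (f z).
  by apply/derivable1_diffP; apply: (@ex_derive _ _ _ _ _ _ _ phid).
apply: is_diff_eq.
  apply: (is_diff_comp fdf (dg := 'd phi (f z))).
  by split.
rewrite funeqE => u /=; rewrite deriv1E; last exact: (@ex_derive _ _ _ _ _ _ _ phid).
by rewrite derive1E (@derive_val _ _ _ _ _ _ _ phid) mulrC.
Qed.

Lemma is_diff_sqrtf z f df : 0 < f z -> is_diff z f df ->
  is_diff z (fun y => Num.sqrt (f y)) (fun u => (2 * Num.sqrt (f z))^-1 * df u).
Proof. by move=> fz0 fdf; apply: is_diff_realcomp; exact: is_derive1_sqrt. Qed.

Lemma is_diff_invf z f df : f z != 0 -> is_diff z f df ->
  is_diff z (fun y => (f y)^-1) (fun u => - (f z) ^- 2 * df u).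
Proof.
move=> fz0 fdf; split; first by apply: differentiableV => //; exact: ex_diff.
by rewrite diffV// ?diff_val//; exact: ex_diff.
Qed.

Lemma is_diff_coord m n z (i : 'I_m) (j : 'I_n) (F : E -> 'M[R]_(m, n)) dF :
  is_diff z F dF -> is_diff z (fun y => F y i j) (fun u => dF u i j).
Proof.
move=> FdF; pose h (M : 'M[R]_(m, n)) := M i j.
have lh : linear h by move=> k A B; rewrite /h !mxE.
pose hL := HB.pack_for {linear 'M[R]_(m, n) -> R} h (GRing.isLinear.Build _ _ _ _ h lh).
have hc : continuous hL by exact: coord_continuous.
have hd : is_diff (F z) h h.
  by split; [exact: differentiable_coord|exact: (diff_lin (F z) hc)].
exact: (is_diff_comp FdF hd).
Qed.

Lemma is_diff_derive z f df u : is_diff z f df -> 'D_u f z = df u.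
Proof. by move=> fdf; rewrite deriveE; [rewrite diff_val|apply: ex_diff]. Qed.

End Calculus.

Lemma is_diff_fst (R : realType) (E F : normedModType R) (z : E * F) :
  is_diff z fst fst.
Proof.
have c : continuous (fst : {linear (E * F)%type -> E}) by move=> p; exact: cvg_fst.
by split; [exact: (linear_differentiable z c)|exact: (diff_lin z c)].
Qed.

Lemma is_diff_snd (R : realType) (E F : normedModType R) (z : E * F) :
  is_diff z snd snd.
Proof.
have c : continuous (snd : {linear (E * F)%type -> F}) by move=> p; exact: cvg_snd.
by split; [exact: (linear_differentiable z c)|exact: (diff_lin z c)].
Qed.

Lemma cst_of_derive0 (R : realType) (g : R -> R) (t0 t1 : R) :
  (forall t, t0 < t < t1 -> is_derive t 1 g 0) ->
  forall s t, t0 < s < t1 -> t0 < t < t1 -> g s = g t.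
Proof.
move=> g0; have key s t : t0 < s < t1 -> t0 < t < t1 -> s < t -> g s = g t.
  move=> /andP[t0s st1] /andP[t0t tt1] st.
  have g0' x : x \in `[s, t] -> is_derive x 1 g 0.
    rewrite in_itv/= => /andP[sx xt]; apply: g0.
    by rewrite (lt_le_trans t0s sx) (le_lt_trans xt tt1).
  have gc : {within `[s, t], continuous g}.
    apply: derivable_within_continuous => x xst.
    by apply: (@ex_derive _ _ _ _ _ _ _ (g0' _ xst)).
  have gd x : x \in `]s, t[ -> is_derive x 1 g 0.
    rewrite in_itv/= => /andP[sx xt].
    by apply: g0'; rewrite in_itv/= !ltW.
  have [c _] := @MVT R g (fun=> 0) s t st gd gc.
  by rewrite mul0r => /eqP; rewrite subr_eq0 => /eqP.
move=> s t hs ht; have [st|ts|-> //] := ltgtP s t; first exact: key.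
by apply/esym; exact: key.
Qed.

(** * Euclidean product on the chart and the factor W = |q_{n+1}| *)

Section Dot.
Variables (R : realType) (n : nat).
Implicit Types x y z : 'rV[R]_n.

Definition dot x y : R := \sum_i x 0 i * y 0 i.

Lemma dotC x y : dot x y = dot y x.
Proof. by apply: eq_bigr => i _; rewrite mulrC. Qed.

Lemma dotDr x y z : dot x (y + z) = dot x y + dot x z.
Proof. by rewrite -big_split; apply: eq_bigr => i _; rewrite mxE mulrDr. Qed.

Lemma dotZr (c : R) x y : dot x (c *: y) = c * dot x y.
Proof. by rewrite mulr_sumr; apply: eq_bigr => i _; rewrite mxE mulrCA. Qed.

Lemma dotDl x y z : dot (x + y) z = dot x z + dot y z.
Proof. by rewrite dotC dotDr 2!(dotC z). Qed.

Lemma dotZl (c : R) x y : dot (c *: x) y = c * dot x y.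
Proof. by rewrite dotC dotZr dotC. Qed.

Lemma dotNr x y : dot x (- y) = - dot x y.
Proof. by rewrite -scaleN1r dotZr mulN1r. Qed.

Lemma dotNl x y : dot (- x) y = - dot x y.
Proof. by rewrite dotC dotNr dotC. Qed.

Lemma dot0r x : dot x 0 = 0.
Proof. by rewrite -(scale0r 0) dotZr mul0r. Qed.

Lemma dot_delta x i : dot x (delta_mx 0 i) = x 0 i.
Proof.
rewrite /dot (bigD1 i)//= big1 => [|j ji]; rewrite mxE !eqxx/=.
  by rewrite mulr1 addr0.
by rewrite (negbTE ji) mulr0.
Qed.

Lemma dot_ge0 x : 0 <= dot x x.
Proof. by apply: sumr_ge0 => i _; rewrite -expr2 sqr_ge0. Qed.

(* [lor x] is the absolute value of the coordinate q_{n+1} of [chart x]. *)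
Definition lor x : R := Num.sqrt (1 + dot x x).

Lemma lor_gt0 x : 0 < lor x.
Proof. by rewrite sqrtr_gt0 ltr_wpDr ?dot_ge0. Qed.

Lemma sqr_lor x : lor x ^+ 2 = 1 + dot x x.
Proof. by rewrite sqr_sqrtr// addr_ge0 ?dot_ge0. Qed.

Lemma lor_neq0 x : lor x != 0.
Proof. by rewrite gt_eqF ?lor_gt0. Qed.

Lemma is_diff_dot (E : normedModType R) (v : E) (f g df dg : E -> 'rV[R]_n) :
  is_diff v f df -> is_diff v g dg ->
  is_diff v (fun y : E => dot (f y) (g y))
    (fun u : E => dot (f v) (dg u) + dot (g v) (df u)).
Proof.
move=> fdf gdg; apply: is_diff_eq.
  by apply: is_diff_sumf => i; apply: is_diff_mulf; apply: is_diff_coord.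
by rewrite funeqE => u; rewrite big_split.
Qed.

Lemma is_diff_lor x : is_diff x lor (fun u => dot x u / lor x).
Proof.
have dd := is_diff_addf (is_diff_cstf x 1) (is_diff_dot (is_diff_id x) (is_diff_id x)).
apply: is_diff_eq.
  by apply: (is_diff_sqrtf _ dd); rewrite ltr_wpDr ?dot_ge0.
rewrite funeqE => u /=; rewrite -/(lor x); have := lor_neq0 x => l0.
by field.
Qed.

End Dot.

(** * The canonical chart of the hyperboloid *)

Section Chart.
Variables (R : realType) (n : nat).
Implicit Types (x y u p : 'rV[R]_n) (q v w : 'rV[R]_n.+1).

(** Inverse of the splitting of an ambient vector into its spacelike part [hproj] and its timelike
    coordinate; it reduces Minkowski products to [dot]. *)
Definition glue x (h : R) : 'rV[R]_n.+1 :=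
  \row_j (if unlift ord_max j is Some i then x 0 i else h).

Lemma glue_lift x h i : glue x h 0 (lift ord_max i) = x 0 i.
Proof. by rewrite mxE liftK. Qed.

Lemma glue_max x h : glue x h 0 ord_max = h.
Proof. by rewrite mxE unlift_none. Qed.

Lemma hproj_glue x h : hproj (glue x h) = x.
Proof. by apply/rowP => i; rewrite mxE glue_lift. Qed.

Lemma glue_hproj v : glue (hproj v) (v 0 ord_max) = v.
Proof. by apply/rowP => j; rewrite mxE; case: unliftP => [i|] ->; rewrite ?mxE. Qed.

Lemma mink_dot v w :
  mink v w = dot (hproj v) (hproj w) - v 0 ord_max * w 0 ord_max.
Proof. by congr (_ - _); apply: eq_bigr => i _; rewrite !mxE. Qed.

Lemma mink_glue x y (h k : R) : mink (glue x h) (glue y k) = dot x y - h * k.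
Proof. by rewrite mink_dot !hproj_glue !glue_max. Qed.

Lemma minkC v w : mink v w = mink w v.
Proof. by rewrite !mink_dot dotC mulrC. Qed.

Lemma minkDl v w q : mink (v + w) q = mink v q + mink w q.
Proof.
rewrite !mink_dot (_ : hproj (v + w) = hproj v + hproj w).
  by rewrite dotDl mxE; ring.
by apply/rowP => i; rewrite !mxE.
Qed.

Lemma minkZl (c : R) v q : mink (c *: v) q = c * mink v q.
Proof.
rewrite !mink_dot (_ : hproj (c *: v) = c *: hproj v).
  by rewrite dotZl mxE; ring.
by apply/rowP => i; rewrite !mxE.
Qed.

Lemma chartE x : chart x = glue x (- lor x).
Proof.
by apply/rowP => j; rewrite !mxE; case: (unlift _ _).
Qed.

Lemma hproj_chart x : hproj (chart x) = x.
Proof. by rewrite chartE hproj_glue. Qed.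

Lemma hyperboloid_chart x : hyperboloid (chart x).
Proof.
rewrite /hyperboloid/= chartE mink_glue glue_max oppr_lt0 lor_gt0; split=> //.
by rewrite mulrNN -expr2 sqr_lor opprD addrC subrK.
Qed.

Lemma hyperboloid_last q : hyperboloid q -> q 0 ord_max = - lor (hproj q).
Proof.
move=> [qq q0]; apply: oppr_inj; rewrite opprK.
have [l0 ll] := (lor_gt0 (hproj q), sqr_lor (hproj q)).
apply/eqP; rewrite -(eqrXn2 (n := 2))// ?ltW// ?oppr_gt0//.
by rewrite ll sqrrN; move: qq; rewrite mink_dot expr2 => /eqP; lra.
Qed.

Lemma chart_hproj q : hyperboloid q -> chart (hproj q) = q.
Proof. by move=> hq; rewrite chartE -(hyperboloid_last hq) glue_hproj. Qed.

Lemma is_derive_rV (E : normedModType R) m (z e : E) (f : E -> 'rV[R]_m) (l : 'rV[R]_m) :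
  (forall j, is_derive z e (fun e => f e 0 j) (l 0 j)) -> is_derive z e f l.
Proof.
move=> fl; have df : derivable f z e.
  by apply/derivable_mxP => i j; rewrite ord1; apply: (@ex_derive _ _ _ _ _ _ _ (fl j)).
split=> //; rewrite derive_mx//; apply/rowP => j; rewrite mxE.
exact: (@derive_val _ _ _ _ _ _ _ (fl j)).
Qed.

Lemma is_derive_coord (E : normedModType R) m (z e : E) (f : E -> 'rV[R]_m)
  (l : 'rV[R]_m) j : is_derive z e f l -> is_derive z e (fun e => f e 0 j) (l 0 j).
Proof.
move=> [df <-]; split; first exact: (derivable_mxP _ _ _).1.
by rewrite derive_mx// mxE.
Qed.

Lemma is_derive_glue (E : normedModType R) (z e : E) (f : E -> 'rV[R]_n)
    (g : E -> R) (df : 'rV[R]_n) (dg : R) :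
  is_derive z e f df -> is_derive z e g dg ->
  is_derive z e (fun e => glue (f e) (g e)) (glue df dg).
Proof.
move=> fdf gdg; apply: is_derive_rV => j; rewrite mxE.
under eq_fun do rewrite mxE.
by case: (unlift _ _) => // i; exact: is_derive_coord.
Qed.

Lemma is_derive_hproj (E : normedModType R) (z e : E) (f : E -> 'rV[R]_n.+1) df :
  is_derive z e f df -> is_derive z e (fun e => hproj (f e)) (hproj df).
Proof.
move=> fdf; apply: is_derive_rV => j; rewrite mxE.
by under eq_fun do rewrite mxE; exact: is_derive_coord.
Qed.

Lemma is_diff_is_derive (E F : normedModType R) (z e : E) (f df : E -> F) :
  is_diff z f df -> is_derive z e f (df e).
Proof.
move=> fdf; split; first by apply: diff_derivable; apply: ex_diff.
by rewrite deriveE; [rewrite diff_val|apply: ex_diff].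
Qed.

Lemma is_derive_chart x u :
  is_derive x u (@chart R n) (glue u (- (dot x u / lor x))).
Proof.
rewrite (_ : chart (n:=n) = fun y => glue y (- lor y)); last first.
  by rewrite funeqE => y; rewrite chartE.
apply: is_derive_glue; apply: is_deriveN.
exact: is_diff_is_derive (is_diff_lor x).
Qed.

Lemma dchartE x u : dchart x u = glue u (- (dot x u / lor x)).
Proof. exact: (@derive_val _ _ _ _ _ _ _ (is_derive_chart x u)). Qed.

Lemma mink_dchart x y u :
  mink (dchart x u) (dchart x y) = dot u y - dot x u * dot x y / lor x ^+ 2.
Proof. by rewrite !dchartE mink_glue; have := lor_neq0 x => l0; field. Qed.

Lemma dchart_tangent x u : tangent (chart x) (dchart x u).
Proof.
rewrite /tangent chartE dchartE mink_glue; have := lor_neq0 x => l0.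
by field.
Qed.

(** In the chart the metric is the rank-one perturbation 1 - x^T x / W^2 of the identity. *)
Lemma mul_gram x p : p *m gram x = p - (dot p x / lor x ^+ 2) *: x.
Proof.
have -> : gram x = 1%:M - lor x ^- 2 *: (x^T *m x).
  apply/matrixP => i j; rewrite [LHS]mxE mink_dchart !dot_delta !mxE big_ord1 !mxE eqxx/=.
  by rewrite eq_sym [_ / _]mulrC.
rewrite mulmxBr mulmx1 -scalemxAr mulmxA.
have -> : p *m x^T = (dot p x)%:M.
  by apply/matrixP => i j; rewrite !ord1 !mxE/= mulr1n; apply: eq_bigr => k _; rewrite !mxE.
by rewrite mul_scalar_mx scalerA mulrC.
Qed.

(** Sherman-Morrison: the inverse metric is 1 + x^T x, because 1 + |x|^2 = W^2. *)
Lemma mul_invmx_gram x p : p *m invmx (gram x) = p + dot p x *: x.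
Proof.
have inv r : (r + dot r x *: x) *m gram x = r.
  have l0 : 1 + dot x x != 0 by rewrite -sqr_lor expf_neq0 ?lor_neq0.
  rewrite mul_gram dotDl dotZl sqr_lor -addrA -scalerBl.
  by rewrite (_ : _ - _ = 0) ?scale0r ?addr0//; field.
have gu : gram x \in unitmx.
  (* The preimages of the basis rows given by [inv] form a left inverse of the Gram matrix, hence
     its invertibility. *)
  rewrite -row_free_unit -kermx_eq0.
  pose D : 'M[R]_n := \matrix_(i < n) (delta_mx 0 i + dot (delta_mx 0 i) x *: x).
  have Dg : D *m gram x = 1%:M.
    by apply/row_matrixP => i; rewrite row_mul rowK inv row1.
  by rewrite kermx_eq0 row_free_unit; case: (mulmx1_unit Dg).
by rewrite -[in LHS](inv p) mulmxK.
Qed.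

Lemma sharpE x p :
  sharp x p = glue (p + dot p x *: x) (- (dot p x * lor x)).
Proof.
rewrite /sharp mul_invmx_gram dchartE; congr glue; congr (- _).
rewrite dotDr dotZr (dotC x p) -[X in X + _]mulr1 -mulrDr -sqr_lor.
by have := lor_neq0 x => l0; field.
Qed.

(* The inverse of [sharp x]: the covector g(v, .) in the chart, at x = hproj q. *)
Definition flat q v : 'rV[R]_n :=
  hproj v - (v 0 ord_max / q 0 ord_max) *: hproj q.

(** Tangency gives x.v = q_{n+1} v_{n+1} for the spacelike parts, and |x|^2 = q_{n+1}^2 - 1. *)
Lemma dot_flat_hproj q v : hyperboloid q -> tangent q v ->
  dot (flat q v) (hproj q) = v 0 ord_max / q 0 ord_max.
Proof.
move=> hq; rewrite /tangent mink_dot => qv.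
have q0 : q 0 ord_max != 0 by case: hq => _ /lt_eqF ->.
have [qq _] := hq; move: qq; rewrite mink_dot => qq.
rewrite dotDl dotNl dotZl (dotC (hproj v)).
have -> : dot (hproj q) (hproj v) = q 0 ord_max * v 0 ord_max by lra.
have -> : dot (hproj q) (hproj q) = q 0 ord_max * q 0 ord_max - 1 by lra.
by field.
Qed.

Lemma sharp_flat q v : hyperboloid q -> tangent q v ->
  sharp (hproj q) (flat q v) = v.
Proof.
move=> hq qv; have q0 : q 0 ord_max != 0 by case: hq => _ /lt_eqF ->.
rewrite sharpE dot_flat_hproj// subrK -mulrN -hyperboloid_last// divfK//.
exact: glue_hproj.
Qed.

Lemma canon_flat (F : 'rV[R]_n.+1 -> 'rV[R]_n.+1 -> R) q v :
  hyperboloid q -> tangent q v -> F q v = canon_coord F (hproj q, flat q v).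
Proof. by move=> hq qv; rewrite /canon_coord/= chart_hproj// sharp_flat. Qed.

Lemma mink_flat q v u : hyperboloid q ->
  mink v (dchart (hproj q) u) = dot (flat q v) u.
Proof.
move=> hq; rewrite dchartE mink_dot hproj_glue glue_max dotDl dotNl dotZl.
rewrite (hyperboloid_last hq); have := lor_neq0 (hproj q) => l0.
by field.
Qed.

End Chart.

(** * The integrals in canonical coordinates *)

Section Arcosh.
Variable R : realType.
Implicit Types y c : R.

Lemma expR_arcosh y : 1 <= y ->
  expR (arcosh y) = y + Num.sqrt (y ^+ 2 - 1) /\
  expR (- arcosh y) = y - Num.sqrt (y ^+ 2 - 1).
Proof.
move=> y1; have y21 : 0 <= y ^+ 2 - 1 by rewrite subr_ge0 exprn_ege1.
have E0 : 0 < y + Num.sqrt (y ^+ 2 - 1).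
  by rewrite ltr_pwDl ?sqrtr_ge0// (lt_le_trans ltr01).
have E1 : expR (arcosh y) = y + Num.sqrt (y ^+ 2 - 1) by rewrite lnK// posrE.
split=> //; rewrite expRN E1; apply: (mulfI (lt0r_neq0 E0)).
by rewrite divff ?gt_eqF// mulrC -subr_sqr sqr_sqrtr// opprB addrC subrK.
Qed.

Lemma coth_arcosh y : 1 <= y -> coth (arcosh y) = y / Num.sqrt (y ^+ 2 - 1).
Proof.
move=> y1; rewrite /coth !(expR_arcosh y1).1 (expR_arcosh y1).2.
set r := Num.sqrt _; rewrite (_ : _ + _ + _ = 2 * y); last by ring.
(* Only the factor 2 is cancelled, never r, so y = 1 is covered: there r = 0 and both sides are 0 by
   convention. *)
by rewrite (_ : _ + _ - _ = 2 * r) -?mulf_div ?divff ?mul1r//; ring.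
Qed.

Lemma tanh_arcosh y : 1 <= y -> tanh (arcosh y) = Num.sqrt (y ^+ 2 - 1) / y.
Proof. by move=> y1; rewrite -[RHS]invf_div -coth_arcosh// invf_div. Qed.

End Arcosh.

Lemma sum_lift (R : realType) n (P : pred nat) (F : 'I_n.+1 -> R) :
  \sum_(i < n.+1 | P i && (i < n)%N) F i =
  \sum_(i < n | P i) F (lift ord_max i).
Proof.
rewrite big_mkcond big_ord_recr/= ltnn andbF addr0 [RHS]big_mkcond.
apply: eq_bigr => i _; rewrite ltn_ord andbT.
by congr (if _ then F _ else 0); apply: val_inj; exact: esym (lift_max i).
Qed.

(** The full double sum meets each unordered pair twice, and its diagonal vanishes. *)
Lemma sum_ltn_sym (R : realType) (I : finType) (r : rel I) (F : I -> I -> R) :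
  (forall i j, F i j = F j i) -> (forall i, F i i = 0) ->
  (forall i, r i i = false) -> (forall i j, i != j -> r i j = ~~ r j i) ->
  2 * \sum_i \sum_(j | r i j) F i j = \sum_i \sum_j F i j.
Proof.
move=> Fsym F0 irr tot; rewrite mulr_natl mulr2n.
have -> : \sum_i \sum_j F i j =
    \sum_i (\sum_(j | r i j) F i j + \sum_(j | ~~ r i j) F i j).
  by apply: eq_bigr => i _; rewrite [LHS](bigID (r i)).
rewrite big_split/=; congr (_ + _).
under [RHS]eq_bigr do rewrite big_mkcond.
rewrite [RHS]exchange_big; apply: eq_bigr => i _; rewrite big_mkcond/=.
apply: eq_bigr => j _; have [->|ij] := eqVneq i j; first by rewrite irr F0.
by rewrite (tot _ _ ij) Fsym; case: (r j i).
Qed.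

Lemma lagrange_identity (R : realType) n (x p : 'rV[R]_n) :
  \sum_i \sum_j (x 0 i * p 0 j - x 0 j * p 0 i) ^+ 2 =
  2 * (dot x x * dot p p - dot x p ^+ 2).
Proof.
have E i : \sum_j (x 0 i * p 0 j - x 0 j * p 0 i) ^+ 2 =
    x 0 i ^+ 2 * dot p p + p 0 i ^+ 2 * dot x x - 2 * dot x p * (x 0 i * p 0 i).
  rewrite /dot 3!mulr_sumr mulr_suml -big_split -sumrB; apply: eq_bigr => j _.
  by rewrite /=; ring.
under eq_bigr do rewrite E.
rewrite sumrB big_split/= -!mulr_suml -mulr_sumr.
under eq_bigr do rewrite expr2.
under [X in _ + X * _]eq_bigr do rewrite expr2.
by rewrite -/(dot x x) -/(dot p p) -/(dot x p); ring.
Qed.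

(** * Projections onto the coordinates q_2, ..., q_k *)

Section Mask.
Variables (R : realType) (n : nat).
Implicit Types x y p : 'rV[R]_n.

(* The coordinates q_2, ..., q_k. *)
Definition mask (k : nat) x : 'rV[R]_n :=
  \row_i (if (0 < i < k)%N then x 0 i else 0).

Lemma dot_maskl k x y : dot (mask k x) y = dot x (mask k y).
Proof.
by apply: eq_bigr => i _; rewrite !mxE; case: ifP => _; rewrite ?mul0r ?mulr0.
Qed.

Lemma mask_mask k l x : (k <= l)%N -> mask k (mask l x) = mask k x.
Proof.
move=> kl; apply/rowP => i; rewrite !mxE; case: ifP => // /andP[-> ik] /=.
by rewrite (leq_trans ik).
Qed.

Lemma mask_mask_ge k l x : (k <= l)%N -> mask l (mask k x) = mask k x.
Proof.
move=> kl; apply/rowP => i; rewrite !mxE; case: (ifP (0 < i < k)%N).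
  by move=> /andP[-> ik] /=; rewrite (leq_trans ik).
by rewrite if_same.
Qed.

Lemma maskD k x y : mask k (x + y) = mask k x + mask k y.
Proof. by apply/rowP => i; rewrite !mxE; case: ifP; rewrite ?addr0. Qed.

Lemma maskZ k (c : R) x : mask k (c *: x) = c *: mask k x.
Proof. by apply/rowP => i; rewrite !mxE; case: ifP; rewrite ?mulr0. Qed.

Lemma maskN k x : mask k (- x) = - mask k x.
Proof. by rewrite -scaleN1r maskZ scaleN1r. Qed.

Lemma dot_maskE k x y : dot (mask k x) y = \sum_(i < n | (0 < i < k)%N) x 0 i * y 0 i.
Proof.
rewrite [RHS]big_mkcond; apply: eq_bigr => i _; rewrite mxE.
by case: ifP => _; rewrite ?mul0r.
Qed.

Lemma is_diff_dot_mask k (E : normedModType R) (z : E) (f g df dg : E -> 'rV[R]_n) :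
  is_diff z f df -> is_diff z g dg ->
  is_diff z (fun e => dot (mask k (f e)) (g e))
    (fun e => dot (mask k (f z)) (dg e) + dot (mask k (g z)) (df e)).
Proof.
move=> fdf gdg; under eq_fun do rewrite dot_maskE.
apply: is_diff_eq.
  by apply: is_diff_sumf => i; apply: is_diff_mulf; apply: is_diff_coord.
by rewrite funeqE => u; rewrite big_split !dot_maskE.
Qed.

End Mask.

(** * Force functions and integrals as functions of x and p *)

Section CanonicalForms.
Variables (R : realType) (m : nat).
Local Notation n := m.+1.
Implicit Types (x y p : 'rV[R]_n) (a b f : R).
Let e0 : 'rV[R]_n := delta_mx 0 ord0.

Lemma lift_max_ord0 : lift ord_max (ord0 : 'I_n) = ord0.
Proof. by apply: val_inj; exact: lift_max. Qed.

Lemma dot_split x y : dot x y = x 0 ord0 * y 0 ord0 + dot (mask n x) y.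
Proof.
rewrite dot_maskE /dot (bigD1 ord0)//=; congr (_ + _); apply: eq_bigl => i.
by rewrite ltn_ord andbT lt0n.
Qed.

(** For a^2 < 1, cosh of the distance from Z_0 to either Kepler center. *)
Definition wgt (a : R) : R := (Num.sqrt (1 - a ^+ 2))^-1.

Lemma sqr_wgt (a : R) : a ^+ 2 < 1 -> wgt a ^+ 2 = (1 - a ^+ 2)^-1.
Proof. by move=> a1; rewrite exprVn sqr_sqrtr// subr_ge0 ltW. Qed.

Lemma wgt_gt0 (a : R) : a ^+ 2 < 1 -> 0 < wgt a.
Proof. by move=> a1; rewrite invr_gt0 sqrtr_gt0 subr_gt0. Qed.

(** The operator diag(wgt^2, 1, ..., 1), that is, the quadratic form of E_sp up to the factor
    W^2. *)
Definition lam (a : R) p : 'rV[R]_n := p + ((wgt a ^+ 2 - 1) * p 0 ord0) *: e0.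

Lemma dot_lam a p y : dot (lam a p) y =
  wgt a ^+ 2 * (p 0 ord0 * y 0 ord0) + dot (mask n p) y.
Proof.
rewrite /lam dotDl dotZl (dotC e0) dot_delta dot_split.
by ring.
Qed.

Lemma Z1E a : Z1 a = glue ((a * wgt a) *: e0) (- wgt a) :> 'rV[R]_n.+1.
Proof.
apply/rowP => j; rewrite !mxE; case: unliftP => [i|] ->.
  rewrite !mxE eqxx/= (_ : (lift ord_max i == ord0) = (i == ord0)); last first.
    by rewrite -!val_eqE [val (lift _ _)]lift_max.
  rewrite (_ : (lift ord_max i == ord_max) = false); last first.
    by rewrite eq_sym (negbTE (neq_lift _ _)).
  by case: ifP; rewrite ?mulr1 ?mulr0.
by rewrite eqxx/= div1r.
Qed.

Lemma Z2E a : Z2 a = Z1 (- a) :> 'rV[R]_n.+1.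
Proof. by rewrite /Z2 /Z1 sqrrN mulNr. Qed.

Lemma Z0E : Z0 = glue 0 (- 1) :> 'rV[R]_n.+1.
Proof.
apply/rowP => j; rewrite !mxE; case: unliftP => [i|] ->.
  rewrite !mxE (_ : (lift ord_max i == ord_max) = false); first by rewrite if_same.
  by rewrite eq_sym (negbTE (neq_lift _ _)).
by rewrite eqxx.
Qed.

(* cosh of the distance between Z_1 and [chart x], and its sinh squared. *)
Definition kcosh (a : R) x := wgt a * (lor x - a * x 0 ord0).
Definition ksinh2 (a : R) x :=
  wgt a ^+ 2 * (x 0 ord0 - a * lor x) ^+ 2 + dot (mask n x) x.

Lemma dot_mask_ge0 k (x' : 'rV[R]_n) : 0 <= dot (mask k x') x'.
Proof. by rewrite dot_maskE; apply: sumr_ge0 => i _; rewrite -expr2 sqr_ge0. Qed.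

Lemma ksinh2_ge0 a x : 0 <= ksinh2 a x.
Proof. by rewrite addr_ge0 ?dot_mask_ge0// mulr_ge0 ?sqr_ge0. Qed.

Lemma mink_chart_Z1 a x : - mink (chart x) (Z1 a) = kcosh a x.
Proof. by rewrite chartE Z1E mink_glue dotZr dot_delta /kcosh; ring. Qed.

(** Eliminating q_2, ..., q_n through W^2 = 1 + |x|^2 leaves an identity in W and x_1 that rests on
    wgt^2 a^2 = wgt^2 - 1, which says that Z_1 lies on the hyperboloid. *)
Lemma kcosh_sinh a x : a ^+ 2 < 1 -> kcosh a x ^+ 2 - 1 = ksinh2 a x.
Proof.
move=> a1; rewrite /kcosh /ksinh2 !exprMn.
have -> : dot (mask n x) x = lor x ^+ 2 - 1 - x 0 ord0 ^+ 2.
  by rewrite sqr_lor (dot_split x); ring.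
have := sqr_wgt a1; set s2 := wgt a ^+ 2 => s2E.
have s2a : s2 * a ^+ 2 = s2 - 1.
  have a0 : 1 - a ^+ 2 != 0 by rewrite subr_eq0 eq_sym lt_eqF.
  by rewrite s2E; field.
rewrite !sqrrB !exprMn.
have -> : s2 * (lor x ^+ 2 - lor x * (a * x 0 ord0) *+ 2 + a ^+ 2 * x 0 ord0 ^+ 2) =
  s2 * lor x ^+ 2 - s2 * (lor x * (a * x 0 ord0)) *+ 2 + (s2 * a ^+ 2) * x 0 ord0 ^+ 2.
  by ring.
have -> : s2 * (x 0 ord0 ^+ 2 - x 0 ord0 * (a * lor x) *+ 2 + a ^+ 2 * lor x ^+ 2) =
  s2 * x 0 ord0 ^+ 2 - s2 * (lor x * (a * x 0 ord0)) *+ 2 + (s2 * a ^+ 2) * lor x ^+ 2.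
  by ring.
by rewrite s2a; ring.
Qed.

(** The square exceeds 1 by a sum of squares, and the sign comes from |a x_1| <= |x_1| <= W. *)
Lemma kcosh_ge1 a x : a ^+ 2 < 1 -> 1 <= kcosh a x.
Proof.
move=> a1; rewrite -(@ler_pXn2r _ 2) ?nnegrE ?expr1n//.
  by rewrite -subr_ge0 kcosh_sinh ?ksinh2_ge0.
rewrite mulr_ge0 ?(ltW (wgt_gt0 _))// subr_ge0 (le_trans (ler_norm _))//.
rewrite normrM -[leRHS]mul1r ler_pM//.
  by rewrite -(@ler_pXn2r _ 2) ?nnegrE// real_normK ?num_real// expr1n ltW.
rewrite -(@ler_pXn2r _ 2) ?nnegrE ?(ltW (lor_gt0 _))//.
rewrite real_normK ?num_real// sqr_lor dot_split.
by have := dot_mask_ge0 n x; rewrite expr2; lra.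
Qed.

Lemma kepler_force_chart a (k : R) x : a ^+ 2 < 1 ->
  kepler_force (Z1 a) k (chart x) = k * (kcosh a x / Num.sqrt (ksinh2 a x)).
Proof.
move=> a1; rewrite /kepler_force /hangle mink_chart_Z1 coth_arcosh ?kcosh_ge1//.
by rewrite kcosh_sinh.
Qed.

Lemma hooke_force_chart (f : R) x :
  hooke_force f (chart x) = f * (1 - lor x ^- 2).
Proof.
have l0 := lor_neq0 x.
rewrite /hooke_force /hangle chartE Z0E mink_glue dot0r sub0r mulrNN mulr1 opprK.
have l1 : 1 <= lor x.
  by rewrite -(@ler_pXn2r _ 2) ?nnegrE ?(ltW (lor_gt0 _))// sqr_lor expr1n lerDl dot_ge0.
rewrite tanh_arcosh// exprMn sqr_sqrtr ?subr_ge0 ?exprn_ege1//.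
by field.
Qed.

Lemma E_hypE a k1 k2 f (q v : 'rV[R]_n.+1) :
  E_hyp a k1 k2 f q v = mink v v / 2 - lagrange_force a k1 k2 f q.
Proof.
rewrite /E_hyp /lagrange_force /two_center_force /kepler_force /hooke_force.
by rewrite /tanh /coth !invf_div; ring.
Qed.

Lemma mink_sharp x p : mink (sharp x p) (sharp x p) = dot p p + dot p x ^+ 2.
Proof.
rewrite sharpE mink_glue !(dotDl, dotDr, dotZl, dotZr) (dotC x p).
have -> : - (dot p x * lor x) * - (dot p x * lor x) = dot p x ^+ 2 * (1 + dot x x).
  by rewrite -sqr_lor; ring.
by ring.
Qed.

Lemma chart_lift x (i : 'I_n) : chart x 0 (lift ord_max i) = x 0 i.
Proof. by rewrite chartE glue_lift. Qed.

Lemma chart_max x : chart x 0 ord_max = - lor x.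
Proof. by rewrite chartE glue_max. Qed.

Lemma sharp_max x p : sharp x p 0 ord_max = - (dot p x * lor x).
Proof. by rewrite sharpE glue_max. Qed.

Lemma sharp_lift x p (i : 'I_n) :
  sharp x p 0 (lift ord_max i) = p 0 i + dot p x * x 0 i.
Proof. by rewrite sharpE glue_lift !mxE. Qed.

(** The velocity has spacelike part p + (p.x) x, whose radial term drops out of q_i v_j - q_j v_i;
    the Lagrange identity then sums the squares. *)
Lemma C_hat_canon k x p : (k <= n)%N ->
  C_hat k (chart x) (sharp x p) =
  dot (mask k x) x * dot (mask k p) p - dot (mask k x) p ^+ 2.
Proof.
move=> kn; apply: (@mulfI _ 2); first by rewrite pnatr_eq0.
have mE (y z : 'rV[R]_n) : dot (mask k y) z = dot (mask k y) (mask k z).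
  by rewrite -dot_maskl mask_mask.
rewrite (mE x) (mE p) (mE x p) -lagrange_identity -(@sum_ltn_sym _ _ (fun i j : 'I_n => (i < j)%N)); last 4 first.
- by move=> i j; ring.
- by move=> i; rewrite subrr expr0n.
- by move=> i; rewrite ltnn.
- by move=> i j; rewrite -val_eqE/= => ij; rewrite -leqNgt ltn_neqAle ij.
congr (_ * _); rewrite /C_hat.
rewrite big_ord_recr/= [X in _ + X]big1 ?addr0; last first.
  move=> j /andP[nj jk]; have := ltn_trans nj jk.
  by rewrite ltnNge kn.
apply: eq_bigr => i _.
have -> : widen_ord (leqnSn n) i = lift ord_max i.
  by apply: val_inj; exact: esym (lift_max i).
rewrite (eq_bigl (fun j : 'I_n.+1 => [&& (0 < i)%N, (i < j)%N & (j < k)%N] && (j < n)%N)); last first.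
  by move=> j; case: (ltnP j k) => jk; rewrite ?andbF// (leq_trans jk kn) !andbT.
apply: (etrans (sum_lift (fun j => [&& (0 < i)%N, (i < j)%N & (j < k)%N]) _)).
rewrite big_mkcond [RHS]big_mkcond; apply: eq_bigr => j _.
rewrite !chart_lift !sharp_lift !mxE.
case: (ltnP i j) => ij; rewrite ?andbF//=.
case: (ltnP 0 i) => i0 /=; last by rewrite !mul0r !mulr0 subrr expr0n.
rewrite (ltn_trans i0 ij)/=.
case: (ltnP j k) => jk /=; last by rewrite !mul0r !mulr0 subrr expr0n.
by rewrite (ltn_trans ij jk); ring.
Qed.

(* The force function of the projected spherical problem. *)
Definition kepler_proj a x : R := wgt a * (lor x / Num.sqrt (ksinh2 a x)).
Definition hooke_proj a x : R := dot (lam a x) x / lor x ^+ 2.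
Definition lagrange_proj a k1 k2 f x : R :=
  k1 * kepler_proj a x + k2 * kepler_proj (- a) x + f * hooke_proj a x.

Lemma wgtN a : wgt (- a) = wgt a.
Proof. by rewrite /wgt sqrrN. Qed.

(** The terms in p.x cancel in q_{n+1} v_i - q_i v_{n+1}, which equals - W p_i. *)
Lemma E_sp_canon a k1 k2 f x p : a ^+ 2 < 1 ->
  E_sp a k1 k2 f (chart x) (sharp x p) =
  lor x ^+ 2 * dot (lam a p) p / 2 - lagrange_proj a k1 k2 f x.
Proof.
move=> a1; have l0 := lor_neq0 x; have s2 := sqr_wgt a1.
rewrite /E_sp -lift_max_ord0 !chart_lift !sharp_lift chart_max sharp_max.
have sumE (F : 'I_n.+1 -> R) : \sum_(i < n.+1 | (0 < i < n)%N) F i =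
    \sum_(i < n | (0 < i < n)%N) F (lift ord_max i).
  apply: (etrans (sum_lift (fun i => 0 < i)%N _)).
  by apply: eq_bigl => i; rewrite ltn_ord andbT.
rewrite !sumE.
under eq_bigr do rewrite chart_lift sharp_lift.
under [\sum_(i < n | _) (chart x 0 _ ^+ 2 / _)]eq_bigr do rewrite chart_lift.
have -> : \sum_(i < n | (0 < i < n)%N) (x 0 i ^+ 2 / (- lor x) ^+ 2) =
    dot (mask n x) x / lor x ^+ 2.
  by rewrite -mulr_suml sqrrN dot_maskE.
have -> : \sum_(i < n | (0 < i < n)%N)
    (- lor x * (p 0 i + dot p x * x 0 i) - x 0 i * - (dot p x * lor x)) ^+ 2 =
    lor x ^+ 2 * dot (mask n p) p.
  by rewrite dot_maskE mulr_sumr; apply: eq_bigr => i _; ring.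
(* Stated for b so as to serve both centers, b = a and b = - a. *)
have sqE b : wgt b = wgt a ->
    Num.sqrt ((- x 0 ord0 / - lor x - b) ^+ 2 / (1 - a ^+ 2) +
    dot (mask n x) x / lor x ^+ 2) = Num.sqrt (ksinh2 b x) / lor x.
  move=> ba; rewrite -s2 (_ : _ + _ = ksinh2 b x / lor x ^+ 2).
    by rewrite sqrtrM ?ksinh2_ge0// sqrtrV ?sqr_ge0// sqrtr_sqr gtr0_norm ?lor_gt0.
  by rewrite /ksinh2 ba; field.
have sqEN := sqE (- a) (wgtN a); rewrite opprK in sqEN.
rewrite (sqE a erefl) sqEN !invf_div.
rewrite -/(wgt a) /lagrange_proj /kepler_proj /hooke_proj wgtN !dot_lam sqrrN.
set A := lor x / Num.sqrt (ksinh2 a x); set B := lor x / _.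
by rewrite invfM -!s2; field.
Qed.

End CanonicalForms.

(** * Compatible potentials *)

Section Potentials.
Variables (R : realType) (m : nat).
Local Notation n := m.+1.
Implicit Types (x y : 'rV[R]_n) (a b c : R) (U V : 'rV[R]_n -> R).

(* [U] is the force function in the hyperbolic chart and [V] the projected one;
   their gradients are u x + u' e_1 and v x + v' e_1, and the last two equations
   make the momentum-linear part of {E_hyp, E_sp} vanish. *)
Definition pot_pair a x U V : Prop := exists u u' v v' : R,
  [/\ is_diff x U (fun y => u * dot x y + u' * y 0 ord0),
      is_diff x V (fun y => v * dot x y + v' * y 0 ord0),
      lor x ^+ 2 * u = lor x ^+ 2 * v + v' * x 0 ord0
    & v' = lor x ^+ 2 * wgt a ^+ 2 * (u' + a ^+ 2 * u * x 0 ord0)].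

Lemma pot_pairD a x U1 V1 U2 V2 : pot_pair a x U1 V1 -> pot_pair a x U2 V2 ->
  pot_pair a x (fun y => U1 y + U2 y) (fun y => V1 y + V2 y).
Proof.
move=> [u1 [u1' [v1 [v1' [dU1 dV1 e1 e1']]]]] [u2 [u2' [v2 [v2' [dU2 dV2 e2 e2']]]]].
exists (u1 + u2), (u1' + u2'), (v1 + v2), (v1' + v2'); split.
- by apply: is_diff_eq (is_diff_addf dU1 dU2) _; rewrite funeqE => y; ring.
- by apply: is_diff_eq (is_diff_addf dV1 dV2) _; rewrite funeqE => y; ring.
- by rewrite mulrDr e1 e2; ring.
- by rewrite e1' e2'; ring.
Qed.

Lemma pot_pairZ a c x U V : pot_pair a x U V ->
  pot_pair a x (fun y => c * U y) (fun y => c * V y).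
Proof.
move=> [u [u' [v [v' [dU dV e e']]]]].
exists (c * u), (c * u'), (c * v), (c * v'); split.
- by apply: is_diff_eq (is_diff_scalef c dU) _; rewrite funeqE => y; ring.
- by apply: is_diff_eq (is_diff_scalef c dV) _; rewrite funeqE => y; ring.
- by rewrite mulrCA e; ring.
- by rewrite e'; ring.
Qed.

Lemma pot_pair0 a x : pot_pair a x (fun=> 0) (fun=> 0).
Proof.
exists 0, 0, 0, 0; split; try (by rewrite !(mulr0, mul0r, addr0)).
- by apply: is_diff_eq (is_diff_cstf x 0) _; rewrite funeqE => y; ring.
- by apply: is_diff_eq (is_diff_cstf x 0) _; rewrite funeqE => y; ring.
Qed.

(** The relations involve a only through its square, so the second center is treated as the first
    one with - a for a. *)
Lemma pot_pairN a x U V : pot_pair (- a) x U V -> pot_pair a x U V.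
Proof. by rewrite /pot_pair wgtN sqrrN. Qed.

Lemma is_diff_kcosh b x :
  is_diff x (kcosh b) (fun y => wgt b * (dot x y / lor x - b * y 0 ord0)).
Proof.
apply: is_diff_scalef; apply: is_diff_subf; first exact: is_diff_lor.
by apply: is_diff_scalef; apply: is_diff_coord; exact: is_diff_id.
Qed.

Lemma pot_kepler b x : b ^+ 2 < 1 -> ksinh2 b x != 0 ->
  pot_pair b x (fun y => kcosh b y / Num.sqrt (ksinh2 b y)) (kepler_proj b).
Proof.
move=> b1 N0; have N0' : 0 < ksinh2 b x by rewrite lt0r N0 ksinh2_ge0.
have S0 : Num.sqrt (ksinh2 b x) != 0 by rewrite gt_eqF ?sqrtr_gt0.
have S2 : Num.sqrt (ksinh2 b x) ^+ 2 = kcosh b x ^+ 2 - 1.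
  by rewrite sqr_sqrtr ?ksinh2_ge0// kcosh_sinh.
have l0 := lor_neq0 x.
have dC := is_diff_kcosh b x.
pose dk y := wgt b * (dot x y / lor x - b * y 0 ord0).
have dN : is_diff x (ksinh2 b) (fun y => 2 * kcosh b x * dk y).
  (* As sinh^2 = cosh^2 - 1, everything is differentiated through C = [kcosh] alone. *)
  rewrite (_ : ksinh2 b = fun y => kcosh b y * kcosh b y - 1); last first.
    by rewrite funeqE => y; rewrite -kcosh_sinh// expr2.
  apply: is_diff_eq (is_diff_subf (is_diff_mulf dC dC) (is_diff_cstf x 1)) _.
  by rewrite funeqE => y; rewrite /dk; ring.
have dI := is_diff_invf (f := fun y => Num.sqrt (ksinh2 b y)) S0 (is_diff_sqrtf N0' dN).
pose S := Num.sqrt (ksinh2 b x); pose C := kcosh b x.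
(* Coefficients of x.dx and dx_1 in d(C / S) = - dC / S^3 and in d(wgt W / S) = wgt dW / S - wgt W C
   dC / S^3, where dC = wgt (x.dx / W - b dx_1). *)
exists (- S ^- 3 * (wgt b / lor x)), (S ^- 3 * (wgt b * b)),
  (wgt b / (lor x * S) - wgt b ^+ 2 * C / S ^+ 3), (wgt b ^+ 2 * lor x * C * b / S ^+ 3).
have S21 : S ^+ 2 = C ^+ 2 - 1 by [].
have {}S0 : S != 0 by [].
split.
- apply: is_diff_eq (is_diff_mulf dC dI) _; rewrite funeqE => y.
  rewrite -/S -/C -/(dk y); transitivity ((S ^+ 2 - C ^+ 2) * (S ^- 3 * dk y)).
    by field.
  by rewrite S21 /dk; field; rewrite S0 l0.
- have dV := is_diff_scalef (wgt b) (is_diff_mulf (is_diff_lor x) dI).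
  apply: is_diff_eq dV _.
  rewrite funeqE => y; rewrite -/S -/C /dk; field.
  by rewrite S0 l0.
- have -> : lor x ^+ 2 * (- S ^- 3 * (wgt b / lor x)) =
      - (lor x * wgt b * S ^- 3) * (C ^+ 2 - S ^+ 2).
    by rewrite S21; field; rewrite S0 l0.
  rewrite {1}/C /kcosh; rewrite -/C.
  have -> : C ^+ 2 = C * (wgt b * (lor x - b * x 0 ord0)) by rewrite expr2.
  by field; rewrite S0 l0.
- rewrite /C /kcosh; field.
  by rewrite S0 l0.
Qed.

Lemma is_diff_hooke_force x (f : R) :
  is_diff x (fun y => f * (1 - lor y ^- 2)) (fun y => 2 * f / lor x ^+ 4 * dot x y).
Proof.
have dl := is_diff_lor x; have l0 := lor_neq0 x.
have l20 : lor x * lor x != 0 by rewrite mulf_neq0.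
apply: is_diff_eq (is_diff_scalef f (is_diff_subf (is_diff_cstf x 1) (is_diff_invf (f := fun y => lor y * lor y) l20 (is_diff_mulf dl dl)))) _.
by rewrite funeqE => y; field.
Qed.

Lemma pot_hooke a x : a ^+ 2 < 1 ->
  pot_pair a x (fun y => 1 - lor y ^- 2) (hooke_proj a).
Proof.
move=> a1; have dl := is_diff_lor x; have l0 := lor_neq0 x.
have l20 : lor x * lor x != 0 by rewrite mulf_neq0.
have sa : wgt a ^+ 2 = 1 + a ^+ 2 * wgt a ^+ 2.
  have a0 : 1 - a ^+ 2 != 0 by rewrite subr_eq0 eq_sym lt_eqF.
  by rewrite sqr_wgt//; field.
have dx0 : is_diff x (fun y => y 0 ord0) (fun y => y 0 ord0).
  exact: is_diff_coord (is_diff_id x).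
have dB : is_diff x (fun y => dot (lam a y) y)
    (fun y => 2 * dot x y + 2 * (a ^+ 2 * wgt a ^+ 2) * x 0 ord0 * y 0 ord0).
  rewrite (_ : (fun y => _) = fun y => dot y y + (a ^+ 2 * wgt a ^+ 2) * (y 0 ord0 * y 0 ord0)); last first.
    by rewrite funeqE => y; rewrite dot_lam [in LHS]sa (dot_split y); ring.
  apply: is_diff_eq (is_diff_addf (is_diff_dot (is_diff_id x) (is_diff_id x)) (is_diff_scalef _ (is_diff_mulf dx0 dx0))) _.
  by rewrite funeqE => y /=; ring.
pose B := dot (lam a x) x.
exists (2 / lor x ^+ 4), 0, (2 / lor x ^+ 2 - 2 * B / lor x ^+ 4),
  (2 * (a ^+ 2 * wgt a ^+ 2) * x 0 ord0 / lor x ^+ 2); split.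
- under eq_fun do rewrite -[_ - _]mul1r.
  by apply: is_diff_eq (is_diff_hooke_force x 1) _; rewrite funeqE => y; ring.
- apply: is_diff_eq (is_diff_mulf dB (is_diff_invf (f := fun y => lor y * lor y) l20 (is_diff_mulf dl dl))) _.
  by rewrite funeqE => y; rewrite -/B; field.
- have -> : B = lor x ^+ 2 - 1 + a ^+ 2 * wgt a ^+ 2 * x 0 ord0 ^+ 2.
    by rewrite /B dot_lam [in LHS]sa sqr_lor (dot_split x); ring.
  by field.
- by field.
Qed.

(** A vanishing sum of squares forces q_2 = ... = q_n = 0 and x_1 = a W; then W^2 = 1 + a^2 W^2
    gives W = wgt. *)
Lemma chart_Z1 a x : a ^+ 2 < 1 -> ksinh2 a x = 0 -> chart x = Z1 a.
Proof.
move=> a1 /eqP; rewrite paddr_eq0 ?dot_mask_ge0 ?(mulr_ge0 (sqr_ge0 _) (sqr_ge0 _))//.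
rewrite mulf_eq0 !expf_eq0/= gt_eqF ?wgt_gt0//= subr_eq0 => /andP[/eqP x0 /eqP xp].
have xi i : i != ord0 -> x 0 i = 0.
  move=> i0; apply/eqP; rewrite -sqrf_eq0.
  move/eqP: xp; rewrite dot_maskE psumr_eq0 => [/allP/(_ i)|j _]; last by rewrite -expr2 sqr_ge0.
  by rewrite mem_index_enum lt0n i0 ltn_ord/= -expr2; apply.
have xE : x = x 0 ord0 *: delta_mx 0 ord0.
  apply/rowP => i; rewrite !mxE eqxx/=; have [->|/xi->] := eqVneq i ord0.
    by rewrite mulr1.
  by rewrite mulr0.
have lE : lor x = wgt a.
  apply/eqP; rewrite -(eqrXn2 (n := 2)) ?ltW ?lor_gt0 ?wgt_gt0//.
  have a0 : 1 - a ^+ 2 != 0 by rewrite subr_eq0 eq_sym lt_eqF.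
  rewrite sqr_wgt//; apply/eqP; apply: (mulfI a0); rewrite divff//.
  have := sqr_lor x; rewrite (dot_split x) xp x0 => lx.
  by rewrite mulrBl mul1r; lra.
by rewrite chartE Z1E lE {1}xE x0 lE.
Qed.

Lemma kepler_forceZ0 (Z q : 'rV[R]_n.+1) : kepler_force Z 0 q = 0.
Proof. by rewrite /kepler_force mul0r. Qed.

Lemma lagrange_chart a k1 k2 f x : a ^+ 2 < 1 ->
  lagrange_force a k1 k2 f (chart x) =
  k1 * (kcosh a x / Num.sqrt (ksinh2 a x)) +
  k2 * (kcosh (- a) x / Num.sqrt (ksinh2 (- a) x)) + f * (1 - lor x ^- 2).
Proof.
move=> a1; rewrite /lagrange_force /two_center_force Z2E hooke_force_chart.
by rewrite !kepler_force_chart ?sqrrN.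
Qed.

Lemma pot_lagrange a k1 k2 f x : a ^+ 2 < 1 ->
  ~ two_center_sing a k1 k2 (chart x) ->
  pot_pair a x (lagrange_force a k1 k2 f \o @chart R n) (lagrange_proj a k1 k2 f).
Proof.
move=> a1 nS; rewrite (_ : _ \o _ = fun y => k1 * (kcosh a y / Num.sqrt (ksinh2 a y)) +
    k2 * (kcosh (- a) y / Num.sqrt (ksinh2 (- a) y)) + f * (1 - lor y ^- 2)); last first.
  by rewrite funeqE => y; rewrite /= lagrange_chart.
have kep k b : b ^+ 2 < 1 -> (k != 0 -> chart x != Z1 b) ->
    pot_pair b x (fun y => k * (kcosh b y / Num.sqrt (ksinh2 b y)))
      (fun y => k * kepler_proj b y).
  (* For k = 0 the point may be the center itself, and the pair is the zero pair. *)
  move=> b1 kx; have [->|k0] := eqVneq k 0.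
    by under eq_fun do rewrite mul0r; under [X in pot_pair _ _ _ X]eq_fun do rewrite mul0r; exact: pot_pair0.
  apply: pot_pairZ; apply: pot_kepler => //.
  by apply/eqP => /(chart_Z1 b1); apply/eqP; exact: kx.
apply: pot_pairD; last by apply: pot_pairZ; exact: pot_hooke.
apply: pot_pairD.
  by apply: kep => // k0; apply/eqP => xZ; apply: nS; left.
apply: pot_pairN; apply: kep; rewrite ?sqrrN// -Z2E => k0.
by apply/eqP => xZ; apply: nS; right.
Qed.

End Potentials.

(** * Involution *)

Section PhaseSpace.
Variables (R : realType) (m : nat).
Local Notation n := m.+1.
Local Notation X := 'rV[R]_n.
Implicit Types (x y p : X) (z : X * X) (a f : R).
Implicit Types (F G : 'rV[R]_n.+1 -> 'rV[R]_n.+1 -> R).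
Let e0 : X := delta_mx 0 ord0.

Definition has_grad F z (gx gp : X) : Prop :=
  is_diff z (canon_coord F) (fun u : X * X => dot gx u.1 + dot gp u.2).

Lemma poisson_grad F G z fx fp gx gp :
  has_grad F z fx fp -> has_grad G z gx gp ->
  poisson_bracket F G z = dot fx gp - dot fp gx.
Proof.
move=> dF dG; rewrite /poisson_bracket /dot -sumrB; apply: eq_bigr => i _.
rewrite !(is_diff_derive _ dF) !(is_diff_derive _ dG)/= !dot0r !addr0 !add0r.
by rewrite !dot_delta.
Qed.

Lemma is_diff_fst_comp z (U dU : X -> R) : is_diff (fst z) U dU ->
  is_diff z (fun w : X * X => U w.1) (fun w : X * X => dU w.1).
Proof. by move=> UdU; exact: (is_diff_comp (is_diff_fst z) UdU). Qed.

Lemma grad_E_hyp a k1 k2 f z u u' :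
  is_diff (fst z) (lagrange_force a k1 k2 f \o @chart R n)
    (fun y => u * dot z.1 y + u' * y 0 ord0) ->
  has_grad (E_hyp a k1 k2 f) z
    (dot z.2 z.1 *: z.2 - (u *: z.1 + u' *: e0)) (z.2 + dot z.2 z.1 *: z.1).
Proof.
move=> /is_diff_fst_comp dU; rewrite /has_grad.
rewrite (_ : canon_coord _ = fun w : X * X => 2^-1 * (dot w.2 w.2 + dot w.2 w.1 * dot w.2 w.1)
    - lagrange_force a k1 k2 f (chart w.1)); last first.
  by rewrite funeqE => w; rewrite /canon_coord E_hypE mink_sharp expr2 mulrC.
have dpx := is_diff_dot (is_diff_snd z) (is_diff_fst z).
have dpp := is_diff_dot (is_diff_snd z) (is_diff_snd z).
apply: is_diff_eq (is_diff_subf (is_diff_scalef 2^-1 (is_diff_addf dpp (is_diff_mulf dpx dpx))) dU) _.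
rewrite funeqE => w /=; rewrite !(dotDl, dotNl, dotZl) (dotC e0) dot_delta.
by field.
Qed.

Lemma grad_E_sp a k1 k2 f z v v' : a ^+ 2 < 1 ->
  is_diff (fst z) (lagrange_proj a k1 k2 f)
    (fun y => v * dot z.1 y + v' * y 0 ord0) ->
  has_grad (E_sp a k1 k2 f) z
    (dot (lam a z.2) z.2 *: z.1 - (v *: z.1 + v' *: e0))
    (lor z.1 ^+ 2 *: lam a z.2).
Proof.
move=> a1 /is_diff_fst_comp dV; rewrite /has_grad.
pose s := wgt a ^+ 2.
rewrite (_ : canon_coord _ = fun w : X * X => 2^-1 * ((1 + dot w.1 w.1) *
   ((s - 1) * (w.2 0 ord0 * w.2 0 ord0) + dot w.2 w.2)) - lagrange_proj a k1 k2 f w.1); last first.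
  rewrite funeqE => w; rewrite /canon_coord E_sp_canon// sqr_lor dot_lam (dot_split w.2) -/s.
  by ring.
have dxx := is_diff_dot (is_diff_fst z) (is_diff_fst z).
have dpp := is_diff_dot (is_diff_snd z) (is_diff_snd z).
have dp0 := is_diff_coord 0 ord0 (is_diff_snd z).
apply: is_diff_eq (is_diff_subf (is_diff_scalef 2^-1 (is_diff_mulf (is_diff_addf (is_diff_cstf z 1) dxx)
   (is_diff_addf (is_diff_scalef (s - 1) (is_diff_mulf dp0 dp0)) dpp))) dV) _.
rewrite funeqE => w /=; rewrite !(dotDl, dotNl, dotZl) !(dotC e0) !dot_delta sqr_lor -/s.
by field.
Qed.

Lemma grad_C_hat k z : (k <= n)%N ->
  has_grad (C_hat k) z
    (2 *: (dot (mask k z.2) z.2 *: mask k z.1 - dot (mask k z.1) z.2 *: mask k z.2))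
    (2 *: (dot (mask k z.1) z.1 *: mask k z.2 - dot (mask k z.1) z.2 *: mask k z.1)).
Proof.
move=> kn; rewrite /has_grad.
rewrite (_ : canon_coord _ = fun w : X * X => dot (mask k w.1) w.1 * dot (mask k w.2) w.2
    - dot (mask k w.1) w.2 * dot (mask k w.1) w.2); last first.
  by rewrite funeqE => w; rewrite /canon_coord C_hat_canon// [_ ^+ 2]expr2.
have dxx := is_diff_dot_mask k (is_diff_fst z) (is_diff_fst z).
have dxp := is_diff_dot_mask k (is_diff_fst z) (is_diff_snd z).
have dpp := is_diff_dot_mask k (is_diff_snd z) (is_diff_snd z).
apply: is_diff_eq (is_diff_subf (is_diff_mulf dxx dpp) (is_diff_mulf dxp dxp)) _.
by rewrite funeqE => w /=; rewrite !(dotDl, dotNl, dotZl); ring.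
Qed.

(* Satisfied by the gradient of any function that the rotations of the
   coordinates q_2, ..., q_k leave invariant. *)
Definition rot_sym k z (gx gp : X) : Prop := exists al be de : R,
  mask k gx = al *: mask k z.1 + be *: mask k z.2 /\
  mask k gp = be *: mask k z.1 + de *: mask k z.2.

(** Masking is self-adjoint, so only the masked gradients of F enter. The [al] and [de] terms vanish
    separately, and the two [be] terms cancel because the same coefficient occurs in both
    gradients. *)
Lemma bracket_rot k z F gx gp : (k <= n)%N -> has_grad F z gx gp ->
  rot_sym k z gx gp -> poisson_bracket F (C_hat k) z = 0.
Proof.
move=> kn dF [al [be [de [ex ep]]]].
rewrite (poisson_grad dF (grad_C_hat z kn)) !(dotZr, dotDr, dotNr).
rewrite -!(dot_maskl k) ex ep !(dotDl, dotZl).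
by rewrite (dot_maskl k z.2 z.1) (dotC z.2 (mask k z.1)); ring.
Qed.

Lemma mask_e0 k : mask k e0 = 0.
Proof.
apply/rowP => i; rewrite !mxE; case: ifP => // /andP[i0 _].
by have /negbTE-> : i != ord0 by [rewrite -val_eqE/= -lt0n]; rewrite andbF.
Qed.

Lemma rot_E_hyp k z u u' : rot_sym k z
  (dot z.2 z.1 *: z.2 - (u *: z.1 + u' *: e0)) (z.2 + dot z.2 z.1 *: z.1).
Proof.
exists (- u), (dot z.2 z.1), 1; rewrite !(maskD, maskN, maskZ) mask_e0 scaler0 addr0.
by rewrite scaleNr scale1r addrC; split=> //; rewrite addrC.
Qed.

Lemma rot_E_sp k z a v v' : rot_sym k z
  (dot (lam a z.2) z.2 *: z.1 - (v *: z.1 + v' *: e0)) (lor z.1 ^+ 2 *: lam a z.2).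
Proof.
exists (dot (lam a z.2) z.2 - v), 0, (lor z.1 ^+ 2).
rewrite !(maskD, maskN, maskZ) !mask_e0 !scaler0 !addr0.
by rewrite scalerBl !scale0r addr0 add0r.
Qed.

Lemma rot_C_hat k l z : (k <= l)%N -> rot_sym k z
    (2 *: (dot (mask l z.2) z.2 *: mask l z.1 - dot (mask l z.1) z.2 *: mask l z.2))
    (2 *: (dot (mask l z.1) z.1 *: mask l z.2 - dot (mask l z.1) z.2 *: mask l z.1)).
Proof.
move=> kl; exists (2 * dot (mask l z.2) z.2), (- (2 * dot (mask l z.1) z.2)), (2 * dot (mask l z.1) z.1).
rewrite !(maskZ, maskD, maskN) !mask_mask// !scalerBr !scalerA !scaleNr.
by split=> //; rewrite addrC.
Qed.

Lemma bracket_E a k1 k2 f z u u' v v' : a ^+ 2 < 1 ->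
  is_diff (fst z) (lagrange_force a k1 k2 f \o @chart R n)
    (fun y => u * dot z.1 y + u' * y 0 ord0) ->
  is_diff (fst z) (lagrange_proj a k1 k2 f)
    (fun y => v * dot z.1 y + v' * y 0 ord0) ->
  lor z.1 ^+ 2 * u = lor z.1 ^+ 2 * v + v' * z.1 0 ord0 ->
  v' = lor z.1 ^+ 2 * wgt a ^+ 2 * (u' + a ^+ 2 * u * z.1 0 ord0) ->
  poisson_bracket (E_hyp a k1 k2 f) (E_sp a k1 k2 f) z = 0.
Proof.
move=> a1 dU dV e1 e2; rewrite (poisson_grad (grad_E_hyp dU) (grad_E_sp a1 dV)).
case: z dU dV e1 e2 => x p /= dU dV e1 e2.
have sa : wgt a ^+ 2 * a ^+ 2 = wgt a ^+ 2 - 1.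
  have a0 : 1 - a ^+ 2 != 0 by rewrite subr_eq0 eq_sym lt_eqF.
  by rewrite sqr_wgt//; field.
rewrite !(dotDl, dotNl, dotZl, dotDr, dotNr, dotZr).
rewrite !(dotC e0) !dot_delta (dotC x p) !mxE !eqxx !mulr1.
have -> : dot x x = lor x ^+ 2 - 1 by rewrite sqr_lor; ring.
move: e1 e2; set L := lor x ^+ 2; set s := wgt a ^+ 2; rewrite -/s in sa * => e1 e2.
(* What remains is linear in p: [e1] removes the coefficient of p.x and [e2] that of p_1. *)
transitivity (dot p x * (L * v + v' * x 0 ord0 - L * u) +
    p 0 ord0 * (v' - L * (s * u' + (s - 1) * u * x 0 ord0))); first by ring.
by rewrite e1 subrr mulr0 add0r -sa e2; ring.
Qed.

Lemma poisson_antisym F G z : poisson_bracket F G z = - poisson_bracket G F z.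
Proof.
rewrite /poisson_bracket -sumrN; apply: eq_bigr => i _.
by rewrite opprB [X in X - _]mulrC [X in _ - X]mulrC.
Qed.

Lemma poisson_self F z : poisson_bracket F F z = 0.
Proof.
have /eqP := poisson_antisym F F z.
by rewrite -addr_eq0 -mulr2n mulrn_eq0 => /eqP.
Qed.

Definition grad_p a (l : 'I_n) z : X :=
  match val l with
  | 0 => z.2 + dot z.2 z.1 *: z.1
  | 1 => lor z.1 ^+ 2 *: lam a z.2
  | k => 2 *: (dot (mask k.+1 z.1) z.1 *: mask k.+1 z.2
               - dot (mask k.+1 z.1) z.2 *: mask k.+1 z.1)
  end.

Lemma lagrange_grad a k1 k2 f (l : 'I_n) z : a ^+ 2 < 1 ->
  ~ two_center_sing a k1 k2 (chart z.1) ->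
  exists gx, has_grad (lagrange_integrals a k1 k2 f l) z gx (grad_p a l z).
Proof.
move=> a1 /(pot_lagrange f a1)[u [u' [v [v' [dU dV _ _]]]]].
case: l => -[|[|k]] kn; rewrite /lagrange_integrals /grad_p/=.
- by eexists; exact: grad_E_hyp dU.
- by eexists; exact: grad_E_sp dV.
- by eexists; exact: grad_C_hat.
Qed.

Lemma lagrange_bracket a k1 k2 f (i j : 'I_n) z : a ^+ 2 < 1 ->
  ~ two_center_sing a k1 k2 (chart z.1) ->
  poisson_bracket (lagrange_integrals a k1 k2 f i) (lagrange_integrals a k1 k2 f j) z = 0.
Proof.
move=> a1 /(pot_lagrange f a1)[u [u' [v [v' [dU dV e1 e2]]]]].
wlog ij : i j / (i <= j)%N.
  move=> main; have [/main//|/ltnW/main] := leqP i j.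
  by move=> ji0; rewrite poisson_antisym ji0 oppr0.
case: j i ij => -[|[|k]] kn [[|[|l]] ln] //= lk; rewrite /lagrange_integrals/=.
- exact: poisson_self.
- exact: bracket_E dU dV e1 e2.
- exact: poisson_self.
- exact: bracket_rot (grad_E_hyp dU) (rot_E_hyp _ _ _ _).
- exact: bracket_rot (grad_E_sp a1 dV) (rot_E_sp _ _ _ _ _).
(* The C of larger index is invariant under the rotations belonging to the smaller one, so it has to
   come first. *)
- rewrite poisson_antisym (bracket_rot _ (grad_C_hat z kn) (rot_C_hat _ _))// ?oppr0//.
Qed.

End PhaseSpace.

(** * Conservation along motions *)

Lemma is_derive_diff (R : realType) (W : normedModType R) (f : R -> W) (t : R) df :
  is_derive t (1 : R) f df -> is_diff t f (fun h => h *: df).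
Proof.
move=> [fd fdf]; split; first exact/derivable1_diffP.
by rewrite deriv1E// derive1E fdf.
Qed.

Section Motions.
Variables (R : realType) (m : nat).
Local Notation n := m.+1.
Local Notation X := 'rV[R]_n.
Local Notation V := 'rV[R]_n.+1.
Variables (U : V -> R) (S : set V) (t0 t1 : R) (q : R -> V).
Hypothesis qm : is_motion U S t0 t1 q.

Lemma near_itv t (P : R -> Prop) : t0 < t < t1 ->
  (forall s, t0 < s < t1 -> P s) -> \forall s \near t, P s.
Proof.
move=> tt hP; have : t \in `]t0, t1[%R by rewrite in_itv.
by move=> /near_in_itvoo; apply: filterS => s; rewrite in_itv => /hP.
Qed.

Lemma motion_derive t : t0 < t < t1 -> is_derive t 1 q (derive1 q t).
Proof. by move=> /qm[_ _ dq _ _]; rewrite derive1E; split. Qed.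

Lemma motion_derive2 t : t0 < t < t1 ->
  is_derive t 1 (derive1 q) (derive1 (derive1 q) t).
Proof. by move=> /qm[_ _ _ dq _]; rewrite derive1E; split. Qed.

Lemma motion_tangent t : t0 < t < t1 -> tangent (q t) (derive1 q t).
Proof.
move=> tt; have dq := motion_derive tt.
have dx := is_derive_diff (is_derive_hproj dq).
have dl := is_derive_diff (is_derive_coord ord_max dq).
have dm := is_diff_is_derive (1 : R) (is_diff_subf (is_diff_dot dx dx) (is_diff_mulf dl dl)).
have dc : is_derive t 1 (fun s => dot (hproj (q s)) (hproj (q s)) -
    q s 0 ord_max * q s 0 ord_max) 0.
  have c : is_derive t (1 : R) (fun=> - 1 : R) 0 by exact: is_derive_cst.
  apply: near_eq_is_derive c; apply: near_itv tt _ => s ss.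
  by have [[qq _] _ _ _ _] := qm ss; rewrite -qq mink_dot.
have := @derive_val _ _ _ _ _ _ _ dm; rewrite (@derive_val _ _ _ _ _ _ _ dc).
rewrite /tangent mink_dot !dotZr !scale1r !mul1r => /eqP.
by lra.
Qed.

(** [flat] kills the normal direction q, so the acceleration and its tangential part have the same
    covector. *)
Lemma flat_accel t (g : X) : t0 < t < t1 ->
  is_diff (hproj (q t)) (U \o @chart R n) (dot g) ->
  flat (q t) (derive1 (derive1 q) t) = g.
Proof.
move=> tt dU; have [hq _ _ _ [_ hg]] := qm tt.
have q0 : q t 0 ord_max != 0 by case: hq => _ /lt_eqF ->.
apply/rowP => i; rewrite -[LHS]dot_delta -[RHS]dot_delta.
have tg : tangent (q t) (dchart (hproj (q t)) (delta_mx 0 i)).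
  by rewrite -{1}(chart_hproj hq); exact: dchart_tangent.
have := hg _ tg; rewrite /dforce (is_diff_derive _ dU) mink_flat//.
rewrite dchartE hproj_glue => <-; congr (dot _ _).
by apply/rowP => j; rewrite /flat !mxE; field.
Qed.

(** In canonical coordinates a motion satisfies x' = p + (p.x) x and p' = grad U - (p.x) p; the last
    hypothesis is then the vanishing of the derivative of F by the chain rule. *)
Lemma motion_const F :
  (forall t, t0 < t < t1 -> exists gx gp u u',
    let x := hproj (q t) in let p := flat (q t) (derive1 q t) in
    [/\ has_grad F (x, p) gx gp,
        is_diff x (U \o @chart R n) (fun y => u * dot x y + u' * y 0 ord0)
      & dot gx (p + dot p x *: x) -
        dot gp (dot p x *: p - (u *: x + u' *: delta_mx 0 ord0)) = 0]) ->
  forall s t, t0 < s < t1 -> t0 < t < t1 ->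
    F (q s) (derive1 q s) = F (q t) (derive1 q t).
Proof.
move=> hF; apply: cst_of_derive0 => t tt.
have [hq _ _ _ _] := qm tt; have tv := motion_tangent tt.
have q0 : q t 0 ord_max != 0 by case: hq => _ /lt_eqF ->.
have [gx [gp [u [u' [dF dU br]]]]] := hF _ tt.
pose x := hproj (q t); pose v := derive1 q t; pose p := flat (q t) v.
have px : dot p x = v 0 ord_max / q t 0 ord_max by exact: dot_flat_hproj.
pose g : X := u *: x + u' *: delta_mx 0 ord0.
have dq := motion_derive tt; have dv := motion_derive2 tt.
have accel : flat (q t) (derive1 (derive1 q) t) = g.
  apply: flat_accel => //; apply: is_diff_eq dU _; rewrite funeqE => y.
  by rewrite /g dotDl !dotZl (dotC (delta_mx _ _)) dot_delta.
have dx : is_derive t 1 (fun s => hproj (q s)) (p + dot p x *: x).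
  have := is_derive_hproj dq; rewrite px /p /flat -/x -/v.
  by rewrite subrK.
(* Differentiating p = v - (v_{n+1} / q_{n+1}) x gives the covector of the acceleration minus
   (v_{n+1} / q_{n+1}) p, where the quotient is p.x. *)
have dp : is_derive t 1 (fun s => flat (q s) (derive1 q s)) (g - dot p x *: p).
  rewrite -accel px; apply: is_derive_rV => j.
  under eq_fun do rewrite !mxE.
  have dvj := is_derive_diff (is_derive_coord (lift ord_max j) dv).
  have dqj := is_derive_diff (is_derive_coord (lift ord_max j) dq).
  have dvm := is_derive_diff (is_derive_coord ord_max dv).
  have dqm := is_derive_diff (is_derive_coord ord_max dq).
  have D := is_diff_subf dvj (is_diff_mulf (is_diff_mulf dvm (is_diff_invf q0 dqm)) dqj).
  have := is_diff_is_derive (1 : R) D; rewrite !scale1r.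
  set l := (X in is_derive _ _ _ X -> _); set r := (X in _ -> is_derive _ _ _ X).
  suff -> : l = r by [].
  by rewrite /l /r /p /flat !mxE -/v; field.
have dz := is_diff_pair (is_derive_diff dx) (is_derive_diff dp).
have := is_diff_is_derive (1 : R) (is_diff_comp dz dF); rewrite /= !scale1r.
have -> : dot gx (p + dot p x *: x) + dot gp (g - dot p x *: p) = 0.
  by rewrite -br -/x -/p -/g -dotNr opprB.
move=> dFz; apply: near_eq_is_derive dFz.
apply: near_itv tt _ => s ss; have [hqs _ _ _ _] := qm ss.
by rewrite [RHS]canon_flat//; exact: motion_tangent.
Qed.

End Motions.

Lemma lagrange_first_integral (R : realType) m (a k1 k2 f : R) (l : 'I_m.+1) :
  a ^+ 2 < 1 ->
  first_integral (lagrange_force a k1 k2 f) (two_center_sing a k1 k2)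
    (lagrange_integrals a k1 k2 f l).
Proof.
move=> a1 t0 t1 q qm; apply: (motion_const qm) => t tt.
have [hq nS _ _ _] := qm _ tt.
set x := hproj (q t); set p := flat _ _.
have nS' : ~ two_center_sing a k1 k2 (chart x) by rewrite chart_hproj.
have [gx dF] := @lagrange_grad _ _ a k1 k2 f l (x, p) a1 nS'.
have [u [u' [v [v' [dU _ _ _]]]]] := pot_lagrange f a1 nS'.
exists gx, (grad_p a l (x, p)), u, u'; split=> //.
have dE := @grad_E_hyp _ _ a k1 k2 f (x, p) u u' dU.
rewrite -(poisson_grad dF dE).
(* The index [ord0] is that of E_hyp. *)
exact: (@lagrange_bracket _ _ a k1 k2 f l ord0).
Qed.

(** * Functional independence *)

Section PolynomialDensity.
Variables (R : realType) (E : normedModType R).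
Implicit Types (f g : E -> R) (z w : E).

(** Being polynomial along every line replaces multivariate polynomials: it suffices for the density
    of the non-vanishing set. *)
Definition polyf f : Prop := continuous f /\
  forall z w, exists P : {poly R}, forall t : R, f (z + t *: w) = P.[t].

Lemma polyf_cst (c : R) : polyf (fun=> c).
Proof.
split; first by move=> z; exact: cvg_cst.
by move=> z w; exists c%:P => t; rewrite hornerC.
Qed.

Lemma polyfD f g : polyf f -> polyf g -> polyf (fun z => f z + g z).
Proof.
move=> [fc fp] [gc gp]; split.
  by move=> z; apply: cvgD; [exact: fc|exact: gc].
move=> z w; have [[P fP] [Q gQ]] := (fp z w, gp z w).
by exists (P + Q) => t; rewrite hornerD fP gQ.
Qed.

Lemma polyfM f g : polyf f -> polyf g -> polyf (fun z => f z * g z).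
Proof.
move=> [fc fp] [gc gp]; split.
  by move=> z; apply: cvgM; [exact: fc|exact: gc].
move=> z w; have [[P fP] [Q gQ]] := (fp z w, gp z w).
by exists (P * Q) => t; rewrite hornerM fP gQ.
Qed.

Lemma polyfB f g : polyf f -> polyf g -> polyf (fun z => f z - g z).
Proof.
move=> hf hg; rewrite (_ : (fun z => _) = fun z => f z + (-1) * g z).
  by apply: polyfD => //; apply: polyfM => //; exact: polyf_cst.
by rewrite funeqE => z; rewrite mulN1r.
Qed.

Lemma polyf_sum (I : Type) (s : seq I) (P : pred I) (f : I -> E -> R) :
  (forall i, polyf (f i)) -> polyf (fun z => \sum_(i <- s | P i) f i z).
Proof.
move=> hf; elim: s => [|i s ih].
  by under eq_fun do rewrite big_nil; exact: polyf_cst.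
under eq_fun do rewrite big_cons.
by case: (P i) => //; exact: polyfD.
Qed.

Lemma open_neq0 f : continuous f -> open [set z | f z != 0].
Proof.
move=> fc; apply: (@open_comp _ _ f [set c | c != 0]); last exact: open_neq.
by move=> z _; exact: fc.
Qed.

Lemma poly_neq0_near0 (P : {poly R}) (e : R) : 0 < e -> P != 0 ->
  exists2 t, `|t| < e & P.[t] != 0.
Proof.
(* The points e/2, e/3, ... are distinct, and [size P] of them outnumber the roots of P; the offset
   2 keeps the first one strictly below e. *)
move=> e0 P0; pose r (k : nat) : R := e / k.+2%:R.
pose rs := [seq r k | k <- iota 0 (size P)].
have [/allP rsP|] := boolP (all (root P) rs).
  have : uniq rs.
    rewrite map_inj_uniq ?iota_uniq// => i j /(mulfI (lt0r_neq0 e0)) /invr_inj /eqP.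
    by rewrite eqr_nat => /eqP[].
  move=> /(max_poly_roots P0 (introT allP rsP)).
  by rewrite size_map size_iota ltnn.
move=> /allPn[t /mapP[k _ ->] rk]; exists (r k) => //.
rewrite ger0_norm ?divr_ge0 ?ler0n ?ltW// /r ltr_pdivrMr ?ltr0n//.
by rewrite ltr_pMr// ltr1n.
Qed.

(** On the line from a point of the open set towards w, f is a polynomial that is non-zero at t = 1,
    so it takes non-zero values at arbitrarily small t. *)
Lemma dense_neq0 f w : polyf f -> f w != 0 -> dense [set z | f z != 0].
Proof.
move=> [_ fp] fw O [z Oz] oO; have [P fP] := fp z (w - z).
have P0 : P != 0.
  apply: contraNneq fw => P0; have := fP 1.
  by rewrite P0 horner0 scale1r addrC subrK => ->.
have cl : continuous (fun t : R => z + t *: (w - z)).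
  move=> t; apply: cvgD; first exact: cvg_cst.
  by apply: cvgZ; [exact: cvg_id|exact: cvg_cst].
have : nbhs (0 : R) [set t | O (z + t *: (w - z))].
  apply: cl; rewrite scale0r addr0; exact: open_nbhs_nbhs.
move=> /nbhs_ballP[e /= e0 he]; have [t te Pt] := poly_neq0_near0 e0 P0.
exists (z + t *: (w - z)); split; last by rewrite /= fP.
by apply: he; rewrite /ball/= sub0r normrN.
Qed.

Lemma open_dense_neq0 (I : finType) (f : I -> E -> R) (w : I -> E) :
  (forall i, polyf (f i)) -> (forall i, f i (w i) != 0) ->
  open [set z | forall i, f i z != 0] /\ dense [set z | forall i, f i z != 0].
Proof.
move=> fp fw; suff [oA dA] : open [set z | forall i, i \in enum I -> f i z != 0] /\
    dense [set z | forall i, i \in enum I -> f i z != 0].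
  rewrite (_ : [set z | forall i, _] = [set z | forall i, i \in enum I -> f i z != 0]) //.
  by apply/seteqP; split => z hz i; [move=> _; exact: hz|apply: hz; rewrite mem_enum].
elim: (enum I) => [|i s [oA dA]].
  rewrite (_ : [set z | _] = setT); last by apply/seteqP; split.
  by split; [exact: openT|move=> O O0 _; rewrite setIT].
rewrite (_ : [set z | _] = [set z | f i z != 0] `&` [set z | forall j, j \in s -> f j z != 0]).
  have oi := open_neq0 (fp i).1.
  by split; [exact: openI|apply: denseI => //; exact: dense_neq0 (fp i) (fw i)].
apply/seteqP; split => [z hz|z [hi hs] j].
  by split; [apply: hz; rewrite mem_head|move=> j js; apply: hz; rewrite inE js orbT].
by rewrite inE => /orP[/eqP->|/hs].
Qed.

End PolynomialDensity.

(** * Independence of the momentum gradients *)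

Section Independence.
Variables (R : realType) (m : nat).
Local Notation n := m.+1.
Local Notation X := 'rV[R]_n.
Hypothesis m0 : (0 < m)%N.
Let i1 : 'I_n := Ordinal (m0 : (1 < n)%N).
Let e0 : X := delta_mx 0 ord0.
Let e1 : X := delta_mx 0 i1.

Lemma polyf_fst (i : 'I_n) : polyf (fun z : X * X => z.1 0 i).
Proof.
split=> [z|z w].
  apply: (@continuous_comp _ _ _ fst (fun x : X => x 0 i)); first exact: cvg_fst.
  exact: coord_continuous.
exists ((z.1 0 i)%:P + w.1 0 i *: 'X) => t.
by rewrite !hornerE !mxE mulrC.
Qed.

Lemma polyf_snd (i : 'I_n) : polyf (fun z : X * X => z.2 0 i).
Proof.
split=> [z|z w].
  apply: (@continuous_comp _ _ _ snd (fun x : X => x 0 i)); first exact: cvg_snd.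
  exact: coord_continuous.
exists ((z.2 0 i)%:P + w.2 0 i *: 'X) => t.
by rewrite !hornerE !mxE mulrC.
Qed.

Lemma polyf_dot_mask (f g : X * X -> X) k :
  (forall i, polyf (fun z => f z 0 i)) -> (forall i, polyf (fun z => g z 0 i)) ->
  polyf (fun z => dot (mask k (f z)) (g z)).
Proof.
move=> hf hg; under eq_fun do rewrite dot_maskE.
by apply: polyf_sum => i; exact: polyfM.
Qed.

Lemma polyf_dot (f g : X * X -> X) :
  (forall i, polyf (fun z => f z 0 i)) -> (forall i, polyf (fun z => g z 0 i)) ->
  polyf (fun z => dot (f z) (g z)).
Proof. by move=> hf hg; apply: polyf_sum => i; exact: polyfM. Qed.

(* Where none of these vanishes, the integrals have independent momentum
   gradients: the second factor is the determinant that separates E_hyp and E_sp,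
   the l-th one the last component of the gradient of C_(l+1). The first
   one only keeps the position off the singular set. *)
Definition indep_factor (a : R) (l : 'I_n) (z : X * X) : R :=
  let x := z.1 in let p := z.2 in
  match val l with
  | 0 => x 0 i1
  | 1 => (dot (mask n x) p + dot p x * dot (mask n x) x) * (wgt a ^+ 2 * p 0 ord0)
         - dot (mask n x) p * (p 0 ord0 + dot p x * x 0 ord0)
  | k => dot (mask k.+1 x) x * p 0 l - dot (mask k.+1 x) p * x 0 l
  end.

Lemma polyf_indep_factor a l : polyf (indep_factor a l).
Proof.
have hx := polyf_fst; have hp := polyf_snd.
case: l => -[|[|k]] kn; rewrite /indep_factor/=.
- exact: hx.
- by repeat first [apply: polyfB|apply: polyfD|apply: polyfM|exact: polyf_cst|
    exact: polyf_dot_mask|exact: polyf_dot|exact: hx|exact: hp].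
- by repeat first [apply: polyfB|apply: polyfD|apply: polyfM|exact: polyf_cst|
    exact: polyf_dot_mask|exact: polyf_dot|exact: hx|exact: hp].
Qed.

Lemma mask_delta k (i : 'I_n) : mask k (delta_mx 0 i : X) =
  if (0 < i < k)%N then delta_mx 0 i else 0.
Proof.
apply/rowP => j; rewrite !mxE eqxx/=; have [->|ji] := eqVneq j i.
  by case: ifP; rewrite mxE ?eqxx.
by case: ifP; case: ifP; rewrite mxE ?eqxx ?(negbTE ji).
Qed.

Lemma indep_factor_neq0 a l : exists z, indep_factor a l z != 0.
Proof.
case: l => -[|[|k]] kn; rewrite /indep_factor/=.
- by exists (e1, 0); rewrite /= mxE !eqxx oner_neq0.
(* With p_1 = 0 the term in [wgt] disappears and the value is -1 for every a. *)
- exists (e0 + e1, e1) => /=; rewrite maskD mask_e0 mask_delta/= ltnS m0 add0r -/e1.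
  rewrite !(dotDr, dotDl) !dot_delta !mxE !eqxx/=.
  by rewrite !(mulr0, mul0r, add0r, addr0, mulr1, mul1r, sub0r, oppr_eq0) oner_neq0.
- set l := Ordinal kn; exists (e1, delta_mx 0 l) => /=.
  rewrite mask_delta/= !dot_delta !mxE !eqxx/=.
  by rewrite !(mulr0, mul0r, add0r, addr0, mulr1, mul1r, subr0) oner_neq0.
Qed.

(** The gradients of all C_k are orthogonal to e_1 and to the masked position, so pairing with these
    two vectors isolates the coefficients of E_hyp and E_sp. The others follow from the triangular
    shape of the gradients of the C_k. *)
Lemma grad_p_independent a z (c : 'I_n -> R) :
  (forall l, indep_factor a l z != 0) ->
  (forall w, \sum_l c l * dot (grad_p a l z) w = 0) -> forall l, c l = 0.
Proof.
case: z => x p hz hc.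
have two w : (forall l : 'I_n, (1 < l)%N -> dot (grad_p a l (x, p)) w = 0) ->
    c ord0 * dot (p + dot p x *: x) w + c i1 * (lor x ^+ 2 * dot (lam a p) w) = 0.
  move=> hw; have := hc w; rewrite (bigD1 ord0)// (bigD1 i1)//= big1 ?addr0; last first.
    move=> l /andP[l0 l1]; rewrite hw ?mulr0//.
    by move: l0 l1; rewrite -!val_eqE/=; case: (val l) => [|[|]].
  by rewrite {1 2}/grad_p/= dotZl.
have /two E0 : forall l : 'I_n, (1 < l)%N -> dot (grad_p a l (x, p)) e0 = 0.
  case=> -[|[|k]] kn //= _; rewrite /grad_p/= dot_delta !mxE /=.
  by rewrite !mulr0 subrr mulr0.
have /two E1 : forall l : 'I_n, (1 < l)%N -> dot (grad_p a l (x, p)) (mask n x) = 0.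
  case=> -[|[|k]] kn //= _; rewrite /grad_p/= dotZl dotDl dotNl !dotZl.
  rewrite -!(dot_maskl n) !mask_mask_ge ?(ltnW kn)//.
  by rewrite (dot_maskl k.+3 p) (dotC p); ring.
set A := dot (mask n x) x; set D := dot (mask n x) p.
have A0 : dot x (mask n x) = A by rewrite dotC.
have D0 : dot p (mask n x) = D by rewrite dotC.
move: E0 E1; rewrite !dot_delta dotDl dotZl A0 D0 /lam dotDl dotZl D0 -dot_maskl mask_e0.
rewrite (dotC 0) dot0r mulr0 addr0 !mxE/= ?eqxx/= mulr1.
set P := dot p x; set L := lor x ^+ 2; set s := wgt a ^+ 2 => E0 E1.
have l0 : L != 0 by rewrite expf_neq0 ?lor_neq0.
have := hz i1; rewrite /indep_factor/= -/A -/D -/P -/s; set Dl := (X in X != 0) => Dl0.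
(* Cramer's rule for [E0] and [E1], whose determinant is - L times [Dl]. *)
have c0 : c ord0 = 0.
  apply/eqP; rewrite -(mulIr_eq0 _ (mulIf Dl0)); apply/eqP.
  transitivity ((c ord0 * (D + P * A) + c i1 * (L * D)) * (s * p 0 ord0) -
     (c ord0 * (p 0 ord0 + P * x 0 ord0) + c i1 * (L * (p 0 ord0 + (s - 1) * p 0 ord0))) * D).
    by rewrite /Dl; ring.
  by rewrite E0 E1; ring.
have c1 : c i1 = 0.
  have LDl : L * Dl != 0 by rewrite mulf_neq0.
  apply/eqP; rewrite -(mulIr_eq0 _ (mulIf LDl)); apply/eqP.
  transitivity ((c ord0 * (p 0 ord0 + P * x 0 ord0) + c i1 * (L * (p 0 ord0 + (s - 1) * p 0 ord0))) * (D + P * A) -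
     (c ord0 * (D + P * A) + c i1 * (L * D)) * (p 0 ord0 + P * x 0 ord0)).
    by rewrite /Dl; ring.
  by rewrite E0 E1; ring.
(* Descending induction on l: in component l the terms of larger index vanish by induction, and the
   gradients of the C of smaller index have no such component. *)
suff down k : forall l : 'I_n, (n - k <= l)%N -> c l = 0.
  by move=> l; apply: (down n); rewrite subnn.
elim: k => [l|k ih l]; first by rewrite subn0 leqNgt ltn_ord.
move=> nl; have [/ih//|ln] := leqP (n - k) l.
have [l1|l1] := leqP l 1.
  have [->|lN] := eqVneq l ord0; first exact: c0.
  rewrite (_ : l = i1) ?c1//; apply: val_inj => /=.
  by apply/eqP; rewrite eqn_leq l1 lt0n.
have := hc (delta_mx 0 l); rewrite (bigD1 l)//= big1 ?addr0; last first.
  move=> j jl; have [jl1|lj] := ltnP j l; last first.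
    rewrite ih ?mul0r//; move: jl; rewrite -val_eqE/= => jl.
    have {}lj : (l < j)%N by rewrite ltn_neqAle eq_sym jl.
    by move: nl lj; lia.
  have [j1|j1] := leqP j 1.
    have [->|jN] := eqVneq j ord0; first by rewrite c0 mul0r.
    rewrite (_ : j = i1) ?c1 ?mul0r//; apply: val_inj => /=.
    by apply/eqP; rewrite eqn_leq j1 lt0n.
  rewrite dot_delta; case: j j1 jl jl1 => -[|[|j]] jn //= _ _ jl1.
  rewrite /grad_p/= !mxE (ltnNge l) jl1 andbF !mulr0 subrr mulr0 mulr0 //.
rewrite dot_delta => /eqP; rewrite mulf_eq0 => /orP[/eqP//|].
have := hz l; case: l l1 {nl ln} => -[|[|l]] ln //= _; rewrite /indep_factor /grad_p/=.
by rewrite !mxE/= leqnn => /negbTE lz; rewrite mulf_eq0 pnatr_eq0 lz.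
Qed.

End Independence.

(** * Reflections at confocal quadrics *)

Section Cosh.
Variable R : realType.
Implicit Types s t y : R.

Definition cosh t : R := (expR t + expR (- t)) / 2.

Lemma coshN t : cosh (- t) = cosh t.
Proof. by rewrite /cosh opprK addrC. Qed.

Lemma cosh_norm t : cosh `|t| = cosh t.
Proof. by case: (ger0P t) => // _; rewrite coshN. Qed.

Lemma ltr_cosh s t : 0 <= s -> s < t -> cosh s < cosh t.
Proof.
move=> s0 st; rewrite -subr_gt0.
have -> : cosh t - cosh s = (expR t - expR s) * (1 - expR (- (s + t))) / 2.
  have es : expR s != 0 by rewrite gt_eqF ?expR_gt0.
  have et : expR t != 0 by rewrite gt_eqF ?expR_gt0.
  by rewrite /cosh !expRN expRD; field; rewrite es et.
rewrite divr_gt0// mulr_gt0// subr_gt0 ?ltr_expR//.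
by rewrite -expR0 ltr_expR oppr_lt0 ltr_pwDr// (le_lt_trans s0).
Qed.

Lemma cosh_inj s t : 0 <= s -> 0 <= t -> cosh s = cosh t -> s = t.
Proof.
move=> s0 t0 st; have [ls|ls|//] := ltgtP s t.
  by have := ltr_cosh s0 ls; rewrite st ltxx.
by have := ltr_cosh t0 ls; rewrite st ltxx.
Qed.

Lemma arcosh_ge0 y : 1 <= y -> 0 <= arcosh y.
Proof. by move=> y1; apply: ln_ge0; rewrite (le_trans y1)// lerDl sqrtr_ge0. Qed.

Lemma cosh_arcosh y : 1 <= y -> cosh (arcosh y) = y.
Proof. by move=> y1; rewrite /cosh (expR_arcosh y1).1 (expR_arcosh y1).2; field. Qed.

Lemma cosh_arcoshD y s : 1 <= y -> 1 <= s ->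
  cosh (arcosh y + arcosh s) = y * s + Num.sqrt (y ^+ 2 - 1) * Num.sqrt (s ^+ 2 - 1).
Proof.
move=> y1 s1; rewrite /cosh opprD !expRD !(expR_arcosh y1).1 !(expR_arcosh y1).2 !(expR_arcosh s1).1 !(expR_arcosh s1).2.
by field.
Qed.

Lemma cosh_arcoshB y s : 1 <= y -> 1 <= s ->
  cosh (arcosh y - arcosh s) = y * s - Num.sqrt (y ^+ 2 - 1) * Num.sqrt (s ^+ 2 - 1).
Proof.
move=> y1 s1; rewrite /cosh opprD opprK !expRD !(expR_arcosh y1).1 !(expR_arcosh y1).2 !(expR_arcosh s1).1 !(expR_arcosh s1).2.
by field.
Qed.

(* The Gram determinant of three points at mutual distances with hyperbolic
   cosines y, s, k; it vanishes exactly in the degenerate triangles. *)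
Definition gram3 (y s k : R) : R := y ^+ 2 + s ^+ 2 - 2 * k * y * s + k ^+ 2 - 1.

(** As a quadratic polynomial in k, its roots are cosh of the sum and of the difference of the two
    distances. *)
Lemma gram3E y s k (A := Num.sqrt (y ^+ 2 - 1)) (B := Num.sqrt (s ^+ 2 - 1)) :
  1 <= y -> 1 <= s ->
  gram3 y s k = (k - (y * s + A * B)) * (k - (y * s - A * B)).
Proof.
move=> y1 s1; have A2 : A ^+ 2 = y ^+ 2 - 1 by rewrite sqr_sqrtr// subr_ge0 exprn_ege1.
have B2 : B ^+ 2 = s ^+ 2 - 1 by rewrite sqr_sqrtr// subr_ge0 exprn_ege1.
have -> : (k - (y * s + A * B)) * (k - (y * s - A * B)) = (k - y * s) ^+ 2 - A ^+ 2 * B ^+ 2 by ring.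
by rewrite A2 B2 /gram3; ring.
Qed.

Lemma gram3_le0 y s K : 1 <= y -> 1 <= s -> gram3 y s K <= 0 ->
  cosh (arcosh y - arcosh s) <= K <= cosh (arcosh y + arcosh s).
Proof.
move=> y1 s1; rewrite gram3E// cosh_arcoshD// cosh_arcoshB//.
set A := _ * Num.sqrt _ => g; have A0 : 0 <= A by rewrite mulr_ge0 ?sqrtr_ge0.
by apply/andP; split; nra.
Qed.

End Cosh.

(** * Confocal walls as central quadrics of the chart, and invariance of the integrals *)

Section Walls.
Variables (R : realType) (m : nat).
Local Notation n := m.+1.
Local Notation X := 'rV[R]_n.
Local Notation V := 'rV[R]_n.+1.
Implicit Types (x u w : X) (a k mu nu : R).

(* Normal covector of the quadric [q_2^2 + ... + q_n^2 - nu q_1^2 = mu]. *)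
Definition quad_normal (nu : R) x : X := mask n x - (nu * x 0 ord0) *: delta_mx 0 ord0.

Definition quad (nu : R) x : R := dot (quad_normal nu x) x.

Lemma dot_quad_normal nu x u :
  dot (quad_normal nu x) u = dot (mask n x) u - nu * x 0 ord0 * u 0 ord0.
Proof. by rewrite dotDl dotNl dotZl (dotC (delta_mx _ _)) dot_delta. Qed.

Definition quad_wall (mu nu : R) : set V :=
  [set q | hyperboloid q /\ quad nu (hproj q) = mu].

(* The constants for which the wall is a quadric with foci Z_1 and Z_2. *)
Definition confocal_coef (a mu nu : R) : Prop :=
  mu != 0 /\ nu * (a ^+ 2 * wgt a ^+ 2) * (1 + mu) + (1 + nu) * mu = 0.

(** Since the two [kcosh] are wgt (W - a x_1) and wgt (W + a x_1), only W^2, x_1^2 and constants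
    survive; replacing W^2 by 1 + |x|^2 gives a central quadric. *)
Lemma gram3_quad a k x : a ^+ 2 < 1 -> k != 1 ->
  gram3 (kcosh a x) (kcosh (- a) x) k = 2 * wgt a ^+ 2 * (1 - k) *
    (quad (a ^+ 2 * (k + 1) / (k - 1) - 1) x - ((1 + k) * (1 - a ^+ 2) / 2 - 1)).
Proof.
move=> a1 k1; have k10 : k - 1 != 0 by rewrite subr_eq0.
have a0 : 1 - a ^+ 2 != 0 by rewrite subr_eq0 eq_sym lt_eqF.
rewrite /gram3 /kcosh /quad dot_quad_normal wgtN !exprMn.
have -> : dot (mask n x) x = lor x ^+ 2 - 1 - x 0 ord0 ^+ 2.
  by rewrite sqr_lor (dot_split x); ring.
have s2 := sqr_wgt a1.
transitivity (wgt a ^+ 2 * ((lor x - a * x 0 ord0) ^+ 2 + (lor x + a * x 0 ord0) ^+ 2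
   - 2 * k * ((lor x - a * x 0 ord0) * (lor x + a * x 0 ord0))) + k ^+ 2 - 1).
  by ring.
by rewrite s2; field; rewrite a0 k10.
Qed.

(** The third argument is cosh of the distance between the centers, so with [gram3_le0] this yields
    the triangle inequalities for Z_1, Z_2 and the point. *)
Lemma gram3_focal a x : a ^+ 2 < 1 ->
  gram3 (kcosh a x) (kcosh (- a) x) (wgt a ^+ 2 * (1 + a ^+ 2)) <= 0.
Proof.
move=> a1; have a0 : 1 - a ^+ 2 != 0 by rewrite subr_eq0 eq_sym lt_eqF.
suff -> : gram3 (kcosh a x) (kcosh (- a) x) (wgt a ^+ 2 * (1 + a ^+ 2)) =
    - (4 * a ^+ 2 * (wgt a ^+ 2) ^+ 2 * dot (mask n x) x).
  rewrite oppr_le0; apply: mulr_ge0; last exact: dot_mask_ge0.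
  by apply: mulr_ge0; [apply: mulr_ge0|]; rewrite ?sqr_ge0.
have -> : dot (mask n x) x = lor x ^+ 2 - 1 - x 0 ord0 ^+ 2.
  by rewrite sqr_lor (dot_split x); ring.
rewrite /gram3 /kcosh wgtN; have s2 := sqr_wgt a1.
set k := wgt a ^+ 2 * (1 + a ^+ 2).
transitivity (wgt a ^+ 2 * ((lor x - a * x 0 ord0) ^+ 2 + (lor x + a * x 0 ord0) ^+ 2
   - 2 * k * ((lor x - a * x 0 ord0) * (lor x + a * x 0 ord0))) + k ^+ 2 - 1).
  by ring.
by rewrite /k s2; field.
Qed.

Lemma hangle_Z1 a x : hangle (Z1 a) (chart x) = arcosh (kcosh a x).
Proof. by rewrite /hangle mink_chart_Z1. Qed.

Lemma hangle_Z1Z2 a : hangle (Z1 a) (Z2 a : V) = arcosh (wgt a ^+ 2 * (1 + a ^+ 2)).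
Proof.
rewrite /hangle Z2E !Z1E wgtN mink_glue dotZl dotZr dot_delta mxE !eqxx/=.
by congr arcosh; ring.
Qed.

Lemma focal_ge1 a : a ^+ 2 < 1 -> 1 <= wgt a ^+ 2 * (1 + a ^+ 2).
Proof.
move=> a1; rewrite sqr_wgt// mulrC ler_pdivlMr ?subr_gt0// mul1r.
by have := sqr_ge0 a; lra.
Qed.

Lemma confocal_quad_wall a (B : set V) : a ^+ 2 < 1 -> confocal_quadric a B ->
  exists mu nu, confocal_coef a mu nu /\ B = quad_wall mu nu.
Proof.
move=> a1; have aN1 : (- a) ^+ 2 < 1 by rewrite sqrrN.
have a0 : 1 - a ^+ 2 != 0 by rewrite subr_eq0 eq_sym lt_eqF.
have K1 := focal_ge1 a1; set K := wgt a ^+ 2 * (1 + a ^+ 2) in K1.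
(* Here k stands for cosh c; mu = 0 would mean k = K, the degenerate case c = d. *)
have red (P : V -> Prop) k : 1 < k -> k != K ->
    (forall x, P (chart x) <-> gram3 (kcosh a x) (kcosh (- a) x) k = 0) ->
    exists mu nu, confocal_coef a mu nu /\
      [set q | hyperboloid q /\ P q] = quad_wall mu nu.
  move=> k1 kK hP; have k10 : k - 1 != 0 by rewrite subr_eq0 gt_eqF.
  exists ((1 + k) * (1 - a ^+ 2) / 2 - 1), (a ^+ 2 * (k + 1) / (k - 1) - 1).
  split; [split|].
  - apply: contra kK => /eqP e; apply/eqP.
    by rewrite /K sqr_wgt//; apply: (mulfI a0); rewrite mulrA divff// mul1r; lra.
  - by rewrite sqr_wgt//; field; rewrite a0 k10.
  - have wk : 2 * wgt a ^+ 2 * (1 - k) != 0.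
      apply: mulf_neq0; last by rewrite subr_eq0 lt_eqF.
      by rewrite mulf_neq0 ?pnatr_eq0// expf_neq0// gt_eqF ?wgt_gt0.
    apply/seteqP; split=> q /= [hq]; rewrite -{1}(chart_hproj hq).
      move=> /hP; rewrite gram3_quad ?gt_eqF// => /eqP.
      by rewrite mulf_eq0 (negbTE wk) subr_eq0 => /eqP.
    rewrite chart_hproj// => e; split=> //; rewrite -(chart_hproj hq); apply/hP.
    by rewrite gram3_quad ?gt_eqF// e subrr mulr0.
have cK : cosh (hangle (Z1 a) (Z2 a : V)) = K by rewrite hangle_Z1Z2 cosh_arcosh.
have d0 : 0 <= hangle (Z1 a) (Z2 a : V) by rewrite hangle_Z1Z2 arcosh_ge0.
have c0 : cosh 0 = 1 :> R by rewrite /cosh oppr0 expR0 divff.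
case=> [[c dc ->]|[c /andP[cpos cd] ->]].
- have kK := ltr_cosh d0 dc; rewrite cK in kK.
  apply: (red _ (cosh c)); rewrite ?gt_eqF ?(le_lt_trans K1)// => x.
  rewrite Z2E !hangle_Z1.
  have [y1 s1] := (kcosh_ge1 x a1, kcosh_ge1 x aN1).
  (* The spurious root, where the difference of the angles is c up to sign, is excluded because that
     difference is at most d < c. *)
  have /andP[tri _] := gram3_le0 y1 s1 (gram3_focal x a1).
  rewrite gram3E// -cosh_arcoshD// -cosh_arcoshB//; split.
    by move=> <-; rewrite subrr mul0r.
  move=> /eqP; rewrite mulf_eq0 !subr_eq0 => /orP[|] /eqP e.
    by apply: cosh_inj; rewrite ?addr_ge0 ?arcosh_ge0// (le_trans d0 (ltW dc)).
  by have := le_lt_trans tri kK; rewrite e ltxx.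
- have kK := ltr_cosh (ltW cpos) cd; rewrite cK in kK.
  have k1 := ltr_cosh (lexx 0) cpos; rewrite c0 in k1.
  apply: (red _ (cosh c)); rewrite ?lt_eqF// => x.
  rewrite Z2E !hangle_Z1.
  have [y1 s1] := (kcosh_ge1 x a1, kcosh_ge1 x aN1).
  (* Here the spurious root has the sum of the angles equal to c, whereas the sum is at least d >
     c. *)
  have /andP[_ tri] := gram3_le0 y1 s1 (gram3_focal x a1).
  rewrite gram3E// -cosh_arcoshD// -cosh_arcoshB//; split.
    by move=> <-; rewrite cosh_norm subrr mulr0.
  move=> /eqP; rewrite mulf_eq0 !subr_eq0 => /orP[|] /eqP e.
    by have := lt_le_trans kK tri; rewrite e ltxx.
  by apply: cosh_inj; rewrite ?normr_ge0 ?(ltW cpos)// cosh_norm.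
Qed.

Lemma is_derive_near_cst (g : R -> R) (d k : R) :
  is_derive (0 : R) 1 g d -> (\forall t \near (0 : R), g t = k) -> d = 0.
Proof.
move=> gd gk; have c : is_derive (0 : R) (1 : R) g 0.
  have c : is_derive (0 : R) (1 : R) (fun=> k) 0 by exact: is_derive_cst.
  by apply: near_eq_is_derive c; apply: filterS gk => t ->.
by rewrite -(@derive_val _ _ _ _ _ _ _ gd) (@derive_val _ _ _ _ _ _ _ c).
Qed.

Lemma wall_tangent_quad mu nu q v : wall_tangent (quad_wall mu nu) q v ->
  tangent q v /\ dot (quad_normal nu (hproj q)) (hproj v) = 0.
Proof.
move=> [c [cq dc Bc]].
have dx := is_derive_diff (is_derive_hproj dc).
have dl := is_derive_diff (is_derive_coord ord_max dc).
split.
  have dm := is_diff_is_derive (1 : R) (is_diff_subf (is_diff_dot dx dx) (is_diff_mulf dl dl)).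
  have /(is_derive_near_cst dm) : \forall t \near (0 : R),
      dot (hproj (c t)) (hproj (c t)) - c t 0 ord_max * c t 0 ord_max = -1.
    by apply: filterS Bc => t [[qq _] _]; rewrite -qq mink_dot.
  rewrite cq /tangent mink_dot !dotZr !scale1r !mul1r => /eqP.
  by lra.
have d0 := is_diff_coord 0 ord0 dx.
have dm := is_diff_is_derive (1 : R) (is_diff_subf (is_diff_dot_mask n dx dx)
  (is_diff_scalef nu (is_diff_mulf d0 d0))).
have /(is_derive_near_cst dm) : \forall t \near (0 : R),
    dot (mask n (hproj (c t))) (hproj (c t)) - nu * (hproj (c t) 0 ord0 * hproj (c t) 0 ord0) = mu.
  by apply: filterS Bc => t [_ <-]; rewrite /quad dot_quad_normal mulrA.
rewrite cq !scale1r dot_quad_normal => /eqP.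
by lra.
Qed.

(* Rescaling the line x + t u back to the level mu does not change its velocity,
   because quad (x + t u) = mu + t^2 quad u. *)
Lemma quad_wall_tangent mu nu q u : mu != 0 -> quad_wall mu nu q ->
  dot (quad_normal nu (hproj q)) u = 0 ->
  wall_tangent (quad_wall mu nu) q (dchart (hproj q) u).
Proof.
move=> mu0 [hq]; have [x xE] : exists x : X, hproj q = x by exists (hproj q).
rewrite xE => qx Nu.
have quadE (t : R) : quad nu (x + t *: u) = mu + t * t * quad nu u.
  move: Nu; rewrite dot_quad_normal => /eqP; rewrite subr_eq0 => /eqP Mu.
  rewrite -qx /quad !dot_quad_normal maskD maskZ !(dotDl, dotDr, dotZl, dotZr) !mxE.
  by rewrite (dot_maskl n u x) (dotC u (mask n x)) Mu; ring.
pose r (t : R) := 1 + t * t * (quad nu u / mu).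
have dr : is_diff (0 : R) r (fun=> 0).
  have di := is_diff_id (0 : R).
  have D := is_diff_addf (is_diff_cstf (0 : R) 1) (is_diff_mulf (is_diff_mulf di di) (is_diff_cstf (0 : R) (quad nu u / mu))).
  by apply: is_diff_eq D _; rewrite funeqE => h /=; ring.
have r0 : r 0 = 1 by rewrite /r !mul0r addr0.
have r0' : 0 < r 0 by rewrite r0.
pose g (t : R) := (Num.sqrt (r t))^-1.
have dg : is_derive (0 : R) (1 : R) g 0.
  have S0 : Num.sqrt (r 0) != 0 by rewrite r0 sqrtr1 oner_neq0.
  have D := is_diff_is_derive (1 : R) (is_diff_invf (f := fun t => Num.sqrt (r t)) S0 (is_diff_sqrtf r0' dr)).
  by rewrite !mulr0 in D.
have g0 : g 0 = 1 by rewrite /g r0 sqrtr1 invr1.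
pose y (t : R) := g t *: (x + t *: u).
have y0 : y 0 = x by rewrite /y g0 scale1r scale0r addr0.
have dy : is_derive (0 : R) (1 : R) y u.
  apply: is_derive_rV => j; under eq_fun do rewrite !mxE.
  have D := is_diff_mulf (is_derive_diff dg) (is_diff_addf (is_diff_cstf (0 : R) (x 0 j))
    (is_diff_mulf (is_diff_id (0 : R)) (is_diff_cstf (0 : R) (u 0 j)))).
  have := is_diff_is_derive (1 : R) D; rewrite g0 /=.
  by rewrite !(scaler0, mulr0, mul0r, addr0, add0r, mul1r, mulr1).
exists (fun t => chart (y t)); split.
- by rewrite y0 -xE chart_hproj.
- rewrite dchartE; under eq_fun do rewrite chartE.
  apply: is_derive_glue => //; apply: is_deriveN.
  have dl : is_diff (y 0) (@lor R n) (fun e => dot x e / lor x) by rewrite y0; exact: is_diff_lor.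
  have := is_diff_is_derive (1 : R) (is_diff_comp (is_derive_diff dy) dl).
  by rewrite /= scale1r.
- have cr : {for (0 : R), continuous r} by apply: differentiable_continuous; exact: ex_diff.
  have : \forall t \near (0 : R), 0 < r t.
    exact: (cvgr_gt (r 0) cr).
  apply: filterS => t rt; split; first exact: hyperboloid_chart.
  rewrite hproj_chart.
  have -> : quad nu (y t) = g t ^+ 2 * quad nu (x + t *: u).
    rewrite /y; set e := x + _; rewrite /quad !dot_quad_normal maskZ !(dotZl, dotZr) !mxE.
    by ring.
  rewrite quadE /g exprVn sqr_sqrtr ?ltW//.
  have -> : mu + t * t * quad nu u = r t * mu by rewrite /r; field.
  by rewrite mulKf// gt_eqF.
Qed.

Lemma flatD q (v w : V) : flat q (v + w) = flat q v + flat q w.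
Proof. by apply/rowP => i; rewrite !mxE; ring. Qed.

Lemma flatN q (v : V) : flat q (- v) = - flat q v.
Proof. by apply/rowP => i; rewrite !mxE; ring. Qed.

Lemma reflection_quad a mu nu q v v' : a ^+ 2 < 1 -> confocal_coef a mu nu ->
  quad_wall mu nu q -> reflection (quad_wall mu nu) q v v' ->
  exists vt vn, [/\ [/\ v = vt + vn, v' = vt - vn, tangent q vt & tangent q vn], mink vt vn = 0,
    (exists la, flat q vn = la *: quad_normal nu (hproj q))
    & dot (lam a (flat q vt)) (flat q vn) = 0].
Proof.
move=> a1 [mu0 cc] qB [vt [vn [wt [tn on] -> ->]]]; exists vt, vn.
have [hq qx] := qB; have [tt Nt] := wall_tangent_quad wt.
pose x := hproj q; pose N := quad_normal nu x; pose p := flat q vn.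
have pN : p = (dot p x / mu) *: N.
  apply/rowP => i; rewrite [RHS]mxE -[LHS]dot_delta.
  (* Since N.x = mu is non-zero, subtracting a multiple of x makes the basis vector tangent to the
     quadric; pairing [vn] with it shows that p is proportional to N. *)
  pose u := delta_mx 0 i - (N 0 i / mu) *: x.
  have Nu : dot N u = 0.
    by rewrite dotDr dotNr dotZr dot_delta -/(quad nu x) qx; field.
  have := on _ (quad_wall_tangent mu0 qB Nu); rewrite mink_flat// -/p.
  rewrite dotDr dotNr dotZr => /eqP; rewrite subr_eq0 => /eqP ->.
  by field.
split=> //.
- by rewrite minkC; exact: on.
- by exists (dot p x / mu).
rewrite -/p pN dotZr (_ : dot _ N = 0) ?mulr0//.
rewrite (dotC _ N) dot_quad_normal -/x.
have q0 : q 0 ord_max != 0 by case: hq => _ /lt_eqF ->.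
pose u := hproj vt; pose ta := vt 0 ord_max / q 0 ord_max.
have -> : dot (mask n x) (lam a (flat q vt)) = dot (mask n x) u - ta * dot (mask n x) x.
  have me : dot (mask n x) (delta_mx 0 ord0) = 0 by rewrite dot_maskl mask_e0 dot0r.
  by rewrite /lam /flat -/x -/u -/ta !(dotDr, dotNr, dotZr) me mulr0 addr0.
have -> : lam a (flat q vt) 0 ord0 = wgt a ^+ 2 * (u 0 ord0 - ta * x 0 ord0).
  have lam0 (y z : X) b : lam a (y - b *: z) 0 ord0 = wgt a ^+ 2 * (y 0 ord0 - b * z 0 ord0).
    by rewrite !mxE !eqxx/=; ring.
  exact: lam0.
have uE : dot (mask n x) u = nu * x 0 ord0 * u 0 ord0.
  by apply/eqP; rewrite -subr_eq0 -dot_quad_normal Nt.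
have xE : dot (mask n x) x = mu + nu * x 0 ord0 * x 0 ord0.
  by rewrite -qx /quad dot_quad_normal subrK.
have lE : lor x ^+ 2 = 1 + mu + (1 + nu) * x 0 ord0 ^+ 2.
  by rewrite sqr_lor (dot_split x) xE; ring.
have taE : lor x ^+ 2 * ta = (1 + nu) * x 0 ord0 * u 0 ord0.
  transitivity (dot x u); last by rewrite (dot_split x) uE; ring.
  move: tt; rewrite /tangent mink_dot -/x -/u /ta => /eqP; rewrite subr_eq0 => /eqP ->.
  have -> : lor x ^+ 2 = q 0 ord_max ^+ 2 by rewrite (hyperboloid_last hq) sqrrN.
  by field.
have sa : wgt a ^+ 2 = 1 + a ^+ 2 * wgt a ^+ 2.
  have a0 : 1 - a ^+ 2 != 0 by rewrite subr_eq0 eq_sym lt_eqF.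
  by rewrite sqr_wgt//; field.
(* After multiplication by L = W^2 the left side is a polynomial in x_1 and u_1 that contains the
   confocality relation as a factor. *)
rewrite uE xE sa; apply: (mulfI (expf_neq0 2 (lor_neq0 x))); rewrite mulr0.
move: cc taE lE; set b := a ^+ 2 * wgt a ^+ 2; set L := lor x ^+ 2 => cc taE lE.
transitivity (- (L * nu * x 0 ord0 * u 0 ord0 * b)
  - (L * ta) * (mu - b * nu * x 0 ord0 ^+ 2)); first by ring.
rewrite taE lE.
transitivity (- x 0 ord0 * u 0 ord0 * (nu * b * (1 + mu) + (1 + nu) * mu)); first by ring.
by rewrite cc mulr0.
Qed.

Lemma E_hyp_reflection a k1 k2 f (q vt vn : V) : mink vt vn = 0 ->
  E_hyp a k1 k2 f q (vt + vn) = E_hyp a k1 k2 f q (vt - vn).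
Proof.
move=> tn; rewrite !E_hypE; congr (_ / _ - _).
have sq (w : V) : mink (vt + w) (vt + w) = mink vt vt + 2 * mink vt w + mink w w.
  by rewrite minkDl !(minkC _ (vt + w)) !minkDl (minkC w vt); ring.
rewrite !sq -scaleN1r !(minkC _ (-1 *: vn)) !minkZl (minkC vn (_ *: _)) minkZl.
by rewrite (minkC vn vt) tn; ring.
Qed.

Lemma tangentDB (q vt vn : V) : tangent q vt -> tangent q vn ->
  tangent q (vt + vn) /\ tangent q (vt - vn).
Proof.
rewrite /tangent !(minkC q) !minkDl -scaleN1r minkZl => -> ->.
by rewrite mulr0 addr0.
Qed.

Lemma dot_lamDB a (p p' : X) : dot (lam a p) p' = 0 ->
  dot (lam a (p + p')) (p + p') = dot (lam a (p - p')) (p - p').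
Proof.
rewrite !dot_lam => /eqP; rewrite addrC addr_eq0 => /eqP on.
rewrite !(maskD, maskN) !mxE !(dotDl, dotDr, dotNl, dotNr).
by rewrite (dot_maskl n p' p) (dotC p') on; ring.
Qed.

Lemma E_sp_reflection a k1 k2 f (q vt vn : V) : a ^+ 2 < 1 -> hyperboloid q ->
  tangent q vt -> tangent q vn -> dot (lam a (flat q vt)) (flat q vn) = 0 ->
  E_sp a k1 k2 f q (vt + vn) = E_sp a k1 k2 f q (vt - vn).
Proof.
move=> a1 hq tt tn on.
have [tp tm] := tangentDB tt tn.
rewrite (canon_flat (E_sp a k1 k2 f) hq tp) (canon_flat (E_sp a k1 k2 f) hq tm).
have E x p : canon_coord (E_sp a k1 k2 f) (x, p) =
    lor x ^+ 2 * dot (lam a p) p / 2 - lagrange_proj a k1 k2 f x.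
  exact: E_sp_canon.
rewrite !E; congr (_ * _ / _ - _).
by rewrite flatD flatD flatN; exact: dot_lamDB.
Qed.

(** In the coordinates q_2, ..., q_k the normal covector is a multiple of the position, and adding
    such a multiple to p changes no angular momentum. *)
Lemma C_hat_reflection (k : nat) (q vt vn : V) (la : R) nu : (k <= n)%N -> hyperboloid q ->
  tangent q vt -> tangent q vn -> flat q vn = la *: quad_normal nu (hproj q) ->
  C_hat k q (vt + vn) = C_hat k q (vt - vn).
Proof.
move=> kn hq tt tn pn.
have [tp tm] := tangentDB tt tn.
rewrite (canon_flat (@C_hat R n k) hq tp) (canon_flat (@C_hat R n k) hq tm).
have E y p : canon_coord (@C_hat R n k) (y, p) =
    dot (mask k y) y * dot (mask k p) p - dot (mask k y) p ^+ 2.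
  exact: C_hat_canon.
rewrite !E flatD flatD flatN pn.
set x := hproj q; set p := flat q vt; set N := quad_normal nu x.
have NE (y : X) : dot N (mask k y) = dot (mask k x) y.
  by rewrite dot_quad_normal !mxE /= mulr0 subr0 dot_maskl mask_mask_ge// -dot_maskl.
have E1 (y : X) : dot (mask k N) y = dot (mask k x) y by rewrite dot_maskl NE.
have E2 (y : X) : dot (mask k y) N = dot (mask k x) y by rewrite dotC NE.
move: p N NE E1 E2; move: x => x p N NE E1 E2.
by rewrite !(maskD, maskN, maskZ) !(dotDl, dotDr, dotNr, dotNl, dotZl, dotZr) !E1 !E2; ring.
Qed.

Lemma lagrange_reflection a k1 k2 f S (walls : set (set V)) (l : 'I_n) :
  a ^+ 2 < 1 -> (forall B, walls B -> confocal_quadric a B) ->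
  reflection_invariant S walls (lagrange_integrals a k1 k2 f l).
Proof.
move=> a1 wc B /wc /(confocal_quad_wall a1)[mu [nu [cc ->]]] q v v' qB _ rv.
have [vt [vn [[-> -> tt tn] vv [la pn] pp]]] := reflection_quad a1 cc qB rv.
case: l => -[|[|k]] kn; rewrite /lagrange_integrals/=.
- exact: E_hyp_reflection.
- by apply: E_sp_reflection => //; case: qB.
- by apply: C_hat_reflection pn => //; case: qB.
Qed.

End Walls.

(** * Assembly of the integrability statement, and symmetry of the walls about the Hooke center *)

Section Integrability.
Variables (R : realType) (m : nat).
Local Notation n := m.+1.
Local Notation X := 'rV[R]_n.
Local Notation V := 'rV[R]_n.+1.
Hypothesis m0 : (0 < m)%N.
Implicit Types (a f : R) (walls : set (set V)).

(** Both Kepler centers have q_2 = 0. *)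
Lemma indep_factor_regular a k1 k2 (z : X * X) : indep_factor m0 a ord0 z != 0 ->
  ~ two_center_sing a k1 k2 (chart z.1).
Proof.
rewrite /indep_factor/= => z1.
have hZ b : hproj (Z1 b : V) 0 (Ordinal (m0 : (1 < n)%N)) = 0.
  by rewrite Z1E hproj_glue !mxE -val_eqE/= mulr0.
by case=> -[_ zZ]; move: z1; rewrite -(hproj_chart z.1) zZ ?Z2E hZ eqxx.
Qed.

Lemma lagrange_independent a k1 k2 f :
  a ^+ 2 < 1 -> exists O : set (X * X),
    [/\ open O, dense O, O `<=` regular_phase (two_center_sing a k1 k2)
      & forall z, O z -> independent_at (lagrange_integrals a k1 k2 f) z].
Proof.
move=> a1; have [w hw] := choice (indep_factor_neq0 m0 a).
have [oO dO] := open_dense_neq0 (polyf_indep_factor m0 a) hw.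
exists [set z | forall l, indep_factor m0 a l z != 0]; split=> // z hz.
  exact: indep_factor_regular (hz ord0).
have nS : ~ two_center_sing a k1 k2 (chart z.1) := indep_factor_regular (hz ord0).
(* Directions (0, v) see only the momentum gradients. *)
move=> c hc; apply: (grad_p_independent hz) => v; rewrite -[RHS](hc (0, v)).
apply: eq_bigr => l _; congr (_ * _); have [gx dF] := lagrange_grad f l a1 nS.
by rewrite /has_grad in dF; rewrite diff_val/= dot0r add0r.
Qed.

Lemma lagrange_integrating a k1 k2 f walls : a ^+ 2 < 1 ->
  (forall B, walls B -> confocal_quadric a B) ->
  integrating_family (lagrange_force a k1 k2 f) (two_center_sing a k1 k2) walls
    (lagrange_integrals a k1 k2 f).
Proof.
move=> a1 wc; split.
- move=> l; split; first exact: lagrange_first_integral.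
  move=> z zS; have [gx dF] := lagrange_grad f l a1 zS.
  by rewrite /has_grad in dF; exact: ex_diff.
- exact: lagrange_independent.
- by move=> i j z zS; exact: lagrange_bracket.
- by move=> l; exact: lagrange_reflection.
Qed.

Lemma mink_hooke_symmetry a (q : V) : mink (hooke_symmetry q) (Z1 a) = mink q (Z1 (- a)).
Proof.
have qE : hooke_symmetry q = glue (- hproj q) (q 0 ord_max).
  apply/rowP => j; rewrite !mxE; case: unliftP => [i|] ->.
    by rewrite eq_sym (negbTE (neq_lift _ _)) !mxE.
  by rewrite eqxx.
by rewrite qE !Z1E wgtN mink_glue mink_dot hproj_glue glue_max dotNl !dotZr; ring.
Qed.

(** The symmetry exchanges Z_1 and Z_2, and the equation of a wall is symmetric in the two
    angles. *)
Lemma wall_hooke_symmetry a (B : set V) : confocal_quadric a B ->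
  forall q, B q -> B (hooke_symmetry q).
Proof.
have sym (q : V) : hyperboloid q -> [/\ hyperboloid (hooke_symmetry q),
    hangle (Z1 a) (hooke_symmetry q) = hangle (Z2 a) q
    & hangle (Z2 a) (hooke_symmetry q) = hangle (Z1 a) q].
  move=> [qq q0]; split.
  - split; last by rewrite mxE eqxx.
    rewrite -qq /mink !mxE eqxx; congr (_ - _); apply: eq_bigr => i _.
    by rewrite !mxE eq_sym (negbTE (neq_lift _ _)) mulrNN.
  - by rewrite /hangle mink_hooke_symmetry Z2E.
  - by rewrite /hangle Z2E mink_hooke_symmetry opprK.
case=> -[c _ ->] q /= [hq qc]; have [hs s1 s2] := sym q hq.
  by split=> //; rewrite s1 s2 addrC.
by split=> //; rewrite s1 s2 distrC.
Qed.

End Integrability.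

Theorem theorem7 (R : realType) (n : nat) (hn : (3 <= n)%N)
    (a m1 m2 f : R) (ha : 0 < a < 1)
    (walls : set (set 'rV[R]_n.+1)) (walls_fin : finite_set walls)
    (walls_confocal : forall B, walls B -> confocal_quadric a B) :
  [/\ billiard_integrable (lagrange_force a m1 m2 f)
        (two_center_sing a m1 m2) walls,
      integrating_family (lagrange_force a m1 m2 f)
        (two_center_sing a m1 m2) walls (lagrange_integrals a m1 m2 f)
    & [/\ billiard_integrable (two_center_force a m1 m2)
            (two_center_sing a m1 m2) walls,
          billiard_integrable (kepler_force (Z1 a) m1)
            (kepler_sing (Z1 a) m1) walls,
          billiard_integrable (kepler_force (Z2 a) m2)
            (kepler_sing (Z2 a) m2) walls
        & billiard_integrable (hooke_force f) set0 walls /\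
          (forall B, walls B -> forall q, B q -> B (hooke_symmetry q))]].
Proof.
case: n hn walls walls_fin walls_confocal => [//|m] hm walls _ wc.
have m0 : (0 < m)%N by apply: (@leq_trans 2).
have a1 : a ^+ 2 < 1 by rewrite expr_lt1 ?(ltW (andP ha).1)// (andP ha).2.
have main k1 k2 h := lagrange_integrating m0 k1 k2 h a1 wc.
(* Each subcase is a Lagrange problem with some factors zero; by [sing0] a center of factor zero
   contributes no singular point. *)
have sub U S k1 k2 h : U = lagrange_force a k1 k2 h -> S = two_center_sing a k1 k2 ->
    billiard_integrable U S walls.
  by move=> -> ->; exists (lagrange_integrals a k1 k2 h); exact: main.
have sing0 (Z : 'rV[R]_m.+2) : kepler_sing Z 0 = set0.
  by rewrite /kepler_sing; apply/seteqP; split=> q //= -[]; rewrite eqxx.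
split; [exact: sub|exact: main|split; last split].
- apply: (sub _ _ m1 m2 0) => //; rewrite funeqE => q.
  by rewrite /lagrange_force /hooke_force mul0r addr0.
- apply: (sub _ _ m1 0 0); last by rewrite /two_center_sing sing0 setU0.
  rewrite funeqE => q; rewrite /lagrange_force /two_center_force /hooke_force.
  by rewrite kepler_forceZ0 mul0r !addr0.
- apply: (sub _ _ 0 m2 0); last by rewrite /two_center_sing sing0 set0U.
  rewrite funeqE => q; rewrite /lagrange_force /two_center_force /hooke_force.
  by rewrite kepler_forceZ0 mul0r addr0 add0r.
- apply: (sub _ _ 0 0 f); last by rewrite /two_center_sing !sing0 setU0.
  rewrite funeqE => q; rewrite /lagrange_force /two_center_force.
  by rewrite !kepler_forceZ0 !add0r.
- by move=> B /wc; exact: wall_hooke_symmetry.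
Qed.
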